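(* Let $d$ be an integer with $|d|>1$, let $f:A\to A$ be a covering map of degree $d$ of the open annulus $A=(0,1)\times S^1$, and assume that there exists a trivial connector $C$ such that $f(C)=C$. Then there exists a semiconjugacy between $f$ and $m_d$.
   Context: $m_d:S^1\to S^1$, $m_d(z)=z^d$. A semiconjugacy between $f$ and $m_d$ is a continuous map $h:A\to S^1$ with $hf=m_dh$ such that $h_*:H_1(A,\mathbb{Z})\to H_1(S^1,\mathbb{Z})$ is an isomorphism. The degree of $f$ is the integer $d$ such that $f_*$ is multiplication by $d$ on $H_1(A,\mathbb{Z})\cong\mathbb{Z}$. An open set $U\subset A$ is essential if the map $H_1(U,\mathbb{Z})\to H_1(A,\mathbb{Z})=\mathbb{Z}$ induced by inclusion is onto; a subset $X\subset A$ is essential if every open neighbourhood of $X$ in $A$ is essential. A connector is a connected closed subset $C$ of $A$ having accumulation points in both components of the boundary of $A$, i.e. for every $r>0$ there are $(x,y),(x',y')\in C$ with $x<r$ and $x'>1-r$. A connector is trivial if it is not essential. *)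

(* Defs.v *)
From HB Require Import structures.
From mathcomp Require Import all_boot all_order all_algebra.
From mathcomp Require Import complex freeg.
From mathcomp Require Import all_classical all_reals all_analysis.

Set Implicit Arguments.
Unset Strict Implicit.
Unset Printing Implicit Defensive.

Import Order.TTheory GRing.Theory Num.Theory.
Import numFieldNormedType.Exports.

Local Open Scope classical_set_scope.
Local Open Scope ring_scope.
Local Open Scope quotient_scope.

(** * First singular homology group *)

Definition std_simplex (R : realType) (n : nat) : set 'rV[R]_n.+1 :=
  [set t | (forall i, 0 <= t 0 i) /\ \sum_i t 0 i = 1].
Arguments std_simplex : clear implicits.

Section Faces.
Context (R : realType) (n : nat) (i : 'I_n.+2).

(* [t] with a zero coordinate inserted in position [i] *)
Definition face_row (t : 'rV[R]_n.+1) : 'rV[R]_n.+2 :=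
  \row_j oapp (t 0) 0 (unlift i j).

Lemma face_row_simplex (t : 'rV[R]_n.+1) :
  std_simplex R n t -> std_simplex R n.+1 (face_row t).
Proof.
case=> t0 t1; split=> [j|].
  by rewrite mxE; case: unliftP => [k _|_] /=.
rewrite (bigD1_ord i) //= mxE unlift_none /= add0r -[RHS]t1.
by apply: eq_bigr => j _; rewrite mxE liftK.
Qed.

Definition face (t : std_simplex R n) : std_simplex R n.+1 :=
  SigSub (mem_set (face_row_simplex (set_valP t))).

Lemma face_row_continuous : continuous face_row.
Proof.
move=> t P /= [Q Qt QP].
have Qij k j : \forall u \near t, Q k j (face_row u k j).
  have := Qt k j; rewrite mxE; case: (unliftP i j) => [l|] jE Qk; subst j.
    near=> u; rewrite mxE liftK /=; near: u.
    exact: (@coord_continuous R 1 n.+1 0 l t _ Qk).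
  near=> u; rewrite mxE unlift_none /=; exact: nbhs_singleton Qk.
apply: filterS (@filter_forall _ _ _ _ _
  (fun k => @filter_forall _ _ _ _ _ (Qij k))) => u Qu.
by apply: QP => k j; exact: Qu.
Unshelve. all: by end_near. Qed.

Lemma face_continuous : continuous face.
Proof.
apply/continuous_comp_initial => t.
apply: (@continuous_comp _ _ _ (@set_val _ (std_simplex R n)) face_row).
  exact: initial_continuous.
exact: face_row_continuous.
Qed.

HB.instance Definition _ := isContinuous.Build _ _ face face_continuous.
End Faces.

Section Chains.
Context (R : realType) (X : topologicalType).

Definition singular_simplex (n : nat) := continuousType (std_simplex R n) X.

Definition chain (n : nat) := {freeg (singular_simplex n) / int}.

Definition simplex_bdry (n : nat) (s : singular_simplex n.+1) : chain n :=
  \sum_(i < n.+2) << (-1) ^+ i *g (s \o face i : singular_simplex n) >>.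

Definition bdry (n : nat) : chain n.+1 -> chain n := fglift (@simplex_bdry n).

Lemma bdry_is_zmod_morphism n : zmod_morphism (@bdry n).
Proof. exact: lift_is_additive. Qed.
HB.instance Definition _ n :=
  GRing.isZmodMorphism.Build (chain n.+1) (chain n) (@bdry n)
    (@bdry_is_zmod_morphism n).

Lemma bdryU n (s : singular_simplex n.+1) : bdry << s >> = simplex_bdry s.
Proof. by rewrite /bdry liftU scale1r. Qed.
End Chains.

(* [{pred _}] asks for booleans: [is_bdry] is a classical truth value. That
   every boundary is a cycle is not needed, as boundaries are taken among the
   cycles. *)
Section H1.
Context (R : realType) (X : topologicalType).

Definition is_cycle : {pred chain R X 1} := fun c => bdry c == 0.

Lemma is_cycle_zmod_closed : zmod_closed is_cycle.
Proof.
split=> [|x y]; first by rewrite unfold_in /is_cycle raddf0.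
by rewrite !unfold_in /is_cycle raddfB /= => /eqP -> /eqP ->; rewrite subr0.
Qed.
HB.instance Definition _ :=
  GRing.isZmodClosed.Build (chain R X 1) is_cycle is_cycle_zmod_closed.

Record cycle1 := Cycle1 {
  cycle_chain :> chain R X 1;
  cycle_chainP : cycle_chain \in is_cycle }.
HB.instance Definition _ := [isSub for cycle_chain].
HB.instance Definition _ := [Choice of cycle1 by <:].
HB.instance Definition _ := [SubChoice_isSubZmodule of cycle1 by <:].

Definition is_bdry : {pred cycle1} :=
  fun z => `[< exists b : chain R X 2, bdry b = cycle_chain z >].

Lemma is_bdry_zmod_closed : zmod_closed is_bdry.
Proof.
split=> [|x y]; rewrite !unfold_in.
  by apply/asboolP; exists 0; rewrite raddf0.
move=> /asboolP[b bx] /asboolP[c cy]; apply/asboolP; exists (b - c).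
by rewrite raddfB /= bx cy.
Qed.
HB.instance Definition _ :=
  GRing.isZmodClosed.Build cycle1 is_bdry is_bdry_zmod_closed.

Definition H1 : zmodType := Quotient.quot is_bdry.

Definition homology_class (z : cycle1) : H1 := \pi z.

Lemma homology_class_is_zmod_morphism : zmod_morphism homology_class.
Proof. exact: pi_is_zmod_morphism. Qed.
HB.instance Definition _ := GRing.isZmodMorphism.Build cycle1 H1 homology_class
  homology_class_is_zmod_morphism.

Lemma homology_class_surj (a : H1) : exists z, a = homology_class z.
Proof. by exists (repr a); rewrite /homology_class reprK. Qed.

Lemma homology_classP (z w : cycle1) :
  homology_class z = homology_class w <->
  exists b : chain R X 2, bdry b = (z - w : chain R X 1).
Proof.
rewrite /homology_class; split=> [/eqP|]; first last.
  move=> [b bzw]; apply/eqP; rewrite -Quotient.idealrBE unfold_in.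
  by apply/asboolP; exists b.
by rewrite -Quotient.idealrBE unfold_in => /asboolP.
Qed.
End H1.

Section Pushforward.
Context (R : realType) (X Y : topologicalType) (f : continuousType X Y).

Definition push_simplex n (s : singular_simplex R X n) : singular_simplex R Y n :=
  f \o s.

Definition push n : chain R X n -> chain R Y n :=
  fglift (fun s => << push_simplex s >> : chain R Y n).

Lemma push_is_zmod_morphism n : zmod_morphism (@push n).
Proof. exact: lift_is_additive. Qed.
HB.instance Definition _ n :=
  GRing.isZmodMorphism.Build (chain R X n) (chain R Y n) (@push n)
    (@push_is_zmod_morphism n).

Lemma pushU n (s : singular_simplex R X n) : push << s >> = << push_simplex s >>.
Proof. by rewrite /push liftU scale1r. Qed.

Lemma bdry_push n (c : chain R X n.+1) : bdry (push c) = push (bdry c).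
Proof.
rewrite -[c]freeg_sumE !raddf_sum /=; apply: eq_bigr => s _.
rewrite -[coeff s c]intz -freegU_mulz !raddfMz /=; congr (_ *~ _).
rewrite pushU !bdryU /simplex_bdry raddf_sum /=; apply: eq_bigr => i _.
rewrite -[(-1) ^+ i]intz -!freegU_mulz raddfMz /= pushU.
by congr (<< _ >> *~ _); apply/continuousEP.
Qed.

Lemma push_cycle (z : cycle1 R X) : push z \in @is_cycle R Y.
Proof.
by rewrite unfold_in /is_cycle bdry_push (eqP (cycle_chainP z)) raddf0.
Qed.

Definition push_cycle1 (z : cycle1 R X) : cycle1 R Y := Cycle1 (push_cycle z).

(* computed on a representative; [H1mapE] shows it does not depend on it *)
Definition H1map (a : H1 R X) : H1 R Y := homology_class (push_cycle1 (repr a)).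

Lemma H1mapE (z : cycle1 R X) :
  H1map (homology_class z) = homology_class (push_cycle1 z).
Proof.
have /homology_classP[b bzw] :
    homology_class (repr (homology_class z)) = homology_class z.
  exact: reprK.
apply/homology_classP; exists (push b).
by rewrite bdry_push bzw raddfB.
Qed.

Lemma H1map_is_zmod_morphism : zmod_morphism H1map.
Proof.
move=> a b; have [z ->] := homology_class_surj a.
have [w ->] := homology_class_surj b.
rewrite -raddfB !H1mapE -raddfB; congr homology_class.
by apply/val_inj; rewrite /= raddfB.
Qed.
HB.instance Definition _ :=
  GRing.isZmodMorphism.Build (H1 R X) (H1 R Y) H1map H1map_is_zmod_morphism.

End Pushforward.

Definition inclusion (X : topologicalType) (U : set X) : continuousType U X :=
  mkcts (@initial_continuous U X set_val).

(** * Covering maps *)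

Section Covering.
Context (X Y : topologicalType).

Definition homeomorphic_on (f : X -> Y) (V : set X) (U : set Y) : Prop :=
  [/\ set_bij V U f, {within V, continuous f} &
      exists2 g : Y -> X, {within U, continuous g} & {in V, cancel f g}].

Definition evenly_covered (f : X -> Y) (U : set Y) : Prop :=
  exists (I : Type) (V : I -> set X),
    [/\ forall i, open (V i), trivIset setT V, f @^-1` U = \bigcup_i V i &
        forall i, homeomorphic_on f (V i) U].

Definition covering_map (f : X -> Y) : Prop :=
  [/\ continuous f, set_surj setT setT f &
      forall y, exists U : set Y, [/\ open U, U y & evenly_covered f U]].

End Covering.

(** * The circle and the open annulus *)

Section Annulus.
Context (R : realType).

(* [R[i]^o] is the type of complex numbers with the topology of its norm. *)
Definition unit_circle : set R[i]^o := [set z | `|z| = 1].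

Lemma unit_circle_exprz (d : int) (z : unit_circle) :
  unit_circle ((set_val z : R[i]) ^ d).
Proof.
rewrite /unit_circle /=; have z1 : `|set_val z : R[i]| = 1 := set_valP z.
case: d => n; rewrite ?NegzE -?exprnN -?exprnP ?normrV ?normrX ?z1 ?expr1n ?invr1 //.
by rewrite unitfE expf_eq0 -normr_eq0 z1 oner_eq0 andbF.
Qed.

(* z |-> z^d, with [d] possibly negative *)
Definition circle_pow (d : int) (z : unit_circle) : unit_circle :=
  SigSub (mem_set (unit_circle_exprz d z)).

Definition circle : topologicalType := unit_circle : Type.

Definition open_interval : set R := `]0, 1[.

Definition annulus : topologicalType := (open_interval * unit_circle)%type.

(* H_1 of the annulus being infinite cyclic, at most one [d] satisfies this. *)
Definition has_degree (f : continuousType annulus annulus) (d : int) : Prop :=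
  forall a : H1 R annulus, H1map f a = a *~ d.

(* meaningful for [U] open *)
Definition essential_open (U : set annulus) : Prop :=
  forall b : H1 R annulus, exists a : H1 R U,
    H1map (inclusion U) a = b.

Definition essential (E : set annulus) : Prop :=
  forall U : set annulus, open U -> E `<=` U -> essential_open U.

(* The carrier of [annulus] is the open annulus itself, so [closed C] means closed
   relative to it. *)
Definition connector (C : set annulus) : Prop :=
  [/\ connected C, closed C &
      forall r : R, 0 < r -> exists p q : annulus,
        [/\ C p, C q, set_val p.1 < r & 1 - r < set_val q.1]].

Definition trivial_connector (C : set annulus) : Prop :=
  connector C /\ ~ essential C.

(* [H1map h] is additive, so its being an isomorphism means being bijective. *)
Definition semiconjugacy (f : annulus -> annulus) (d : int)
    (h : continuousType annulus circle) : Prop :=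
  h \o f =1 circle_pow d \o h /\ bijective (@H1map R _ _ h).

End Annulus.
Arguments open_interval : clear implicits.
Arguments unit_circle : clear implicits.

(* Main.v *)
Require Import Defs.
From HB Require Import structures.
From mathcomp Require Import all_boot all_order all_algebra.
From mathcomp Require Import complex freeg zify lra ring.
From mathcomp Require Import all_classical all_reals all_analysis.

(* Let [p : R * R -> A] be the universal covering, with deck translation [tau],
   and [F] a lift of [f]; then [F (v + tau) = F v + d tau], and [F] is a
   homeomorphism. A trivial connector [C] lifts to disjoint translates
   [C0 + k tau], each separating the plane, and there is a continuous [phi] with
   [phi (v + tau) = phi v + 1] that takes the value [k] exactly on the [k]-th
   translate. As [F] maps the [k]-th translate onto the [j + d k]-th one, the
   function [phi (F v) - d phi v] is bounded, so that [phi (F^n v) / d^n] converges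
   uniformly to some [H] with [H (F v) = d H v] and [H (v + tau) = H v + 1]; then
   [exp (2 i pi H)] descends to the semiconjugacy.

   Two planar facts are needed: a nonessential neighbourhood of [C] lifts to
   disjoint components, and [C0] separates "above" from "below". Both follow from
   the crossing of two paths of a rectangle that join opposite sides, itself
   proved by lifting the direction [(g t - e s) / |g t - e s|] to a real angle on
   the square. *)

Set Implicit Arguments.
Unset Strict Implicit.
Unset Printing Implicit Defensive.

Import Order.TTheory GRing.Theory Num.Theory.
Import numFieldNormedType.Exports.

Local Open Scope classical_set_scope.
Local Open Scope ring_scope.

(** * The circle *)

(** The difference [phi (F v) - d phi v] is invariant under the deck group, hence a function on the
    annulus; but the annulus is not compact, so continuity alone does not bound it. This is the
    obstacle, and the levels of [phi] stand in for compactness. On the lifted connector the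
    difference is a continuous function with integer values, so connectedness of [C] makes it a
    constant [j]. Away from the connector nothing is known of [f], and the comparison goes through
    the inverse of [F]: a stretch of a vertical line that meets no level [j + d k] has its preimage
    under [F] off every translate of [C0], where the height stays between two consecutive integers.

    The inverse of [F] exists because the plane is simply connected, so that the projection itself
    lifts through the covering [f]. The homology of the annulus is computed by counting turns of
    lifted paths; this identifies the shift by which [F] is equivariant with the degree, and turns
    the factor one in [H (v + tau) = H v + 1] into bijectivity on homology. *)

Section RealContinuity.
Context (R : realType) (X : topologicalType).
Implicit Types (f g : X -> R) (x : X).

Lemma contC (c : R) x : {for x, continuous (fun=> c)}.
Proof. exact: cvg_cst. Qed.

Lemma contD f g x : {for x, continuous f} -> {for x, continuous g} ->
  {for x, continuous (fun t => f t + g t)}.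
Proof. by move=> cf cg; exact: (cvgD cf cg). Qed.

Lemma contB f g x : {for x, continuous f} -> {for x, continuous g} ->
  {for x, continuous (fun t => f t - g t)}.
Proof. by move=> cf cg; exact: (cvgB cf cg). Qed.

Lemma contM f g x : {for x, continuous f} -> {for x, continuous g} ->
  {for x, continuous (fun t => f t * g t)}.
Proof. by move=> cf cg; exact: (cvgM cf cg). Qed.

Lemma contV f x : f x != 0 -> {for x, continuous f} ->
  {for x, continuous (fun t => (f t)^-1)}.
Proof. by move=> f0 cf; exact: (cvgV f0 cf). Qed.

Lemma cont_norm f x : {for x, continuous f} ->
  {for x, continuous (fun t => `|f t|)}.
Proof. by move=> cf; exact: (cvg_norm cf). Qed.

Lemma cont_max f g x : {for x, continuous f} -> {for x, continuous g} ->
  {for x, continuous (fun t => Num.max (f t) (g t))}.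
Proof. by move=> cf cg; apply: continuous_max. Qed.

Lemma cont_min f g x : {for x, continuous f} -> {for x, continuous g} ->
  {for x, continuous (fun t => Num.min (f t) (g t))}.
Proof. by move=> cf cg; apply: continuous_min. Qed.

Lemma cont_comp (Y : topologicalType) (h : R -> Y) f x :
  continuous h -> {for x, continuous f} -> {for x, continuous (fun t => h (f t))}.
Proof. by move=> ch cf; apply: (@continuous_comp _ _ _ f h) => //; exact: ch. Qed.

Lemma cont_pair (Y Z : topologicalType) (f' : X -> Y) (g' : X -> Z) x :
  {for x, continuous f'} -> {for x, continuous g'} ->
  {for x, continuous (fun t => (f' t, g' t))}.
Proof. by move=> cf cg; exact: cvg_pair. Qed.

Lemma cont_fst (Y Z : topologicalType) (h : X -> Y * Z) x :
  {for x, continuous h} -> {for x, continuous (fun t => (h t).1)}.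
Proof.
by move=> ch; apply: (@continuous_comp _ _ _ h fst) => //; exact: cvg_fst.
Qed.

Lemma cont_snd (Y Z : topologicalType) (h : X -> Y * Z) x :
  {for x, continuous h} -> {for x, continuous (fun t => (h t).2)}.
Proof.
by move=> ch; apply: (@continuous_comp _ _ _ h snd) => //; exact: cvg_snd.
Qed.

End RealContinuity.

Section ComplexContinuity.
Context (R : realType).

Lemma continuous_Re : continuous (@complex.Re R : R[i]^o -> R).
Proof.
move=> z; apply/(@cvgrPdist_lt _ R^o _ (nbhs (z : R[i]^o)) (nbhs_filter (z : R[i]^o))) => e e0.
have e0' : (0 : R[i]) < e%:C%C by rewrite ltcR.
have cz : {for z, continuous (fun w : R[i]^o => w)} by exact: cvg_id.
move/(@cvgrPdist_lt _ R[i]^o _ (nbhs (z : R[i]^o)) (nbhs_filter (z : R[i]^o)))/(_ _ e0'): cz; apply: (@filterS _ (nbhs (z : R[i]^o))) => w.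
by rewrite -ltcR; apply: le_lt_trans; rewrite -raddfB /=; exact: normc_ge_Re.
Qed.

Lemma continuous_Im : continuous (@complex.Im R : R[i]^o -> R).
Proof.
move=> z; apply/(@cvgrPdist_lt _ R^o _ (nbhs (z : R[i]^o)) (nbhs_filter (z : R[i]^o))) => e e0.
have e0' : (0 : R[i]) < e%:C%C by rewrite ltcR.
have cz : {for z, continuous (fun w : R[i]^o => w)} by exact: cvg_id.
move/(@cvgrPdist_lt _ R[i]^o _ (nbhs (z : R[i]^o)) (nbhs_filter (z : R[i]^o)))/(_ _ e0'): cz; apply: (@filterS _ (nbhs (z : R[i]^o))) => w.
rewrite -ltcR; apply: le_lt_trans; rewrite -raddfB /= -[in leRHS](mulr1 (z - w)).
(* Multiplication by ['i] is an isometry, and the real part of [(z - w) * 'i] is minus the imaginary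
   part of [z - w]; the bound on real parts applies again. *)
have -> : `|(z - w) * 1| = `|(z - w) * 'i%C|.
  by rewrite !normrM normr1 (normc_def 'i%C) /= expr0n expr1n add0r sqrtr1.
apply: le_trans (normc_ge_Re _); rewrite lecR ReiNIm normrN.
by [].
Qed.

Lemma continuous_complex (X : topologicalType) (a b : X -> R) (x : X) :
  {for x, continuous a} -> {for x, continuous b} ->
  {for x, continuous (fun u => (a u +i* b u)%C : R[i]^o)}.
Proof.
move=> ca cb.
apply/(@cvgrPdist_lt _ R[i]^o) => e; rewrite ltcE /= => /andP[/eqP ie re].
have e2 : 0 < complex.Re e / 2 by rewrite divr_gt0.
have /cvgrPdist_lt/(_ _ e2) ea := ca.
have /cvgrPdist_lt/(_ _ e2) eb := cb.
near=> u.
have -> : (a x +i* b x)%C - (a u +i* b u)%C =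
   ((a x - a u)%:C + 'i * (b x - b u)%:C)%C.
  by apply/eqP; rewrite eq_complex /=; apply/andP; split; apply/eqP; ring.
apply: le_lt_trans (ler_normD _ _) _.
rewrite normrM !normc_def /= !(expr0n, expr1n, add0r, addr0) sqrtr1 mul1r.
rewrite !sqrtr_sqr -rmorphD /= ltcE /= ie eqxx /= [ltRHS]splitr.
by apply: ltrD; near: u.
Unshelve. all: by end_near. Qed.

End ComplexContinuity.

Section Circle.
Context (R : realType).
Implicit Types (z : circle R) (x y : R).

Definition cre z : R := complex.Re (set_val z : R[i]).
Definition cim z : R := complex.Im (set_val z : R[i]).

Lemma continuous_cre : continuous cre.
Proof.
move=> z; apply: (@continuous_comp _ R[i]^o R); first exact: initial_continuous.
exact: continuous_Re.
Qed.

Lemma continuous_cim : continuous cim.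
Proof.
move=> z; apply: (@continuous_comp _ R[i]^o R); first exact: initial_continuous.
exact: continuous_Im.
Qed.

Lemma circle_eq z w : cre z = cre w -> cim z = cim w -> z = w.
Proof.
move=> re im; apply: val_inj; apply/eqP; rewrite eq_complex.
by apply/andP; split; apply/eqP.
Qed.

Lemma circle_norm z : cre z ^+ 2 + cim z ^+ 2 = 1.
Proof.
have := set_valP z; rewrite /unit_circle /= normc_def => -[/(congr1 (fun x => x ^+ 2))].
by rewrite expr1n sqr_sqrtr // addr_ge0 // sqr_ge0.
Qed.

(** Angles are counted in turns, so that the periods of [expi] are the integers. *)
Definition angle x : R := x * (pi *+ 2).

Lemma expi_subproof x :
  unit_circle R (cos (angle x) +i* sin (angle x))%C.
Proof. by rewrite /unit_circle /= normc_def /= cos2Dsin2 sqrtr1. Qed.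

Definition expi x : circle R := SigSub (mem_set (expi_subproof x)).

Lemma cre_expi x : cre (expi x) = cos (angle x). Proof. by []. Qed.
Lemma cim_expi x : cim (expi x) = sin (angle x). Proof. by []. Qed.

Lemma continuous_angle : continuous angle.
Proof. by move=> x; apply: (@contM _ _ id (fun=> pi *+ 2)); [exact: cvg_id|exact: contC]. Qed.

Lemma continuous_expi : continuous expi.
Proof.
apply/continuous_comp_initial => x; apply: continuous_complex.
  by apply: continuous_comp; [exact: continuous_angle|exact: continuous_cos].
by apply: continuous_comp; [exact: continuous_angle|exact: continuous_sin].
Qed.

Lemma expiDz x (n : int) : expi (x + n%:~R) = expi x.
Proof.
have P (k : nat) y : expi (y + k%:R) = expi y.
  apply: circle_eq; rewrite !(cre_expi, cim_expi) /angle mulrDl mulr_natl.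
    by rewrite (periodicn (@cosD2pi R)).
  by rewrite (periodicn (@sinD2pi R)).
case: n => n; first exact: P.
by rewrite NegzE mulrNz -[LHS](P n.+1) -pmulrn subrK.
Qed.

Lemma exprzS (z : R[i]) (n : int) : z != 0 -> z ^ (n + 1) = z ^ n * z.
Proof. by move=> z0; rewrite expfzDr // expr1z. Qed.

Lemma circle_pow_expi x (n : int) : circle_pow n (expi x) = expi (x *~ n).
Proof.
apply: val_inj => /=.
set z : R[i] := (cos (angle x) +i* sin (angle x))%C.
have z0 : z != 0.
  have z1 : `|z| = 1 :> R[i] := expi_subproof x.
  by rewrite -normr_eq0 z1 oner_eq0.
have S (k : int) : (cos (angle (x *~ k)) +i* sin (angle (x *~ k)))%C * z =
    (cos (angle (x *~ (k + 1))) +i* sin (angle (x *~ (k + 1))))%C :> R[i].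
  rewrite /z /angle mulrzDr mulr1z mulrDl cosD sinD; simpc.
  by rewrite [X in Complex _ X]addrC.
elim/int_ind: n => [|n IH|n IH].
- by rewrite expr0z mulr0z /angle mul0r cos0 sin0.
- by rewrite -addn1 PoszD -S -IH exprzS.
- apply: (mulIf z0); rewrite S -exprzS // -addn1 PoszD opprD subrK.
  exact: IH.
Qed.

Lemma cos_eq1 (x : R) : 0 <= x < pi *+ 2 -> cos x = 1 -> x = 0.
Proof.
move=> /andP[x0 x2] cx.
have p0 := @pi_gt0 R.
have [xp|px] := leP x pi.
  by apply: cos_inj; rewrite ?in_itv /= ?x0 ?lexx ?xp ?cos0 ?pi_ge0.
have : cos (pi *+ 2 - x) = cos 0.
  by rewrite cosB cos2pi sin2pi cx mul0r addr0 mulr1 cos0.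
move/cos_inj => /(_ _ _)/eqP.
rewrite !in_itv /= lexx (ltW p0) subr_ge0 (ltW x2) lerBlDr mulr2n lerD2l (ltW px).
by move=> /(_ isT isT); rewrite subr_eq0 => /eqP E; rewrite -E mulr2n ltxx in x2.
Qed.

Lemma expi_inj x y : expi x = expi y -> exists n : int, y = x + n%:~R.
Proof.
move=> E.
have cE : cos (angle (y - x)) = 1.
  rewrite /angle mulrBl cosB -/(angle x) -/(angle y) -!cre_expi -!cim_expi E.
  by rewrite -!expr2 circle_norm.
(* The fractional part of [y - x] is an angle in [[0, 1[] with cosine one, so it vanishes. *)
set n := Num.floor (y - x); exists n.
have := Num.Theory.floor_itv (y - x); rewrite -/n intrD => /andP[n1 n2].
have : expi (y - x) = expi (y - x + (- n)%:~R) by rewrite expiDz.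
move=> /(congr1 cre); rewrite !cre_expi cE => /esym/cos_eq1.
have p0 : 0 < pi *+ 2 :> R by rewrite mulr2n addr_gt0 ?pi_gt0.
rewrite /angle mulrNz pmulr_lge0 // subr_ge0 n1.
rewrite -[X in _ < X]mul1r ltr_pM2r // ltrBlDr [_ + n%:~R]addrC n2 => /(_ isT)/eqP.
rewrite mulf_eq0 (gt_eqF p0) orbF subr_eq0 => /eqP <-; ring.
Qed.

(** The local inverse of [expi] around [expi x]: the argument of [asin] is the sine of the angle
    from [expi x] to [z]. It is used on [half x], the open half circle centred at [expi x], where
    that angle is less than a quarter turn. *)
Definition branch x z : R :=
  x + asin (cos (angle x) * cim z - sin (angle x) * cre z) / (pi *+ 2).

Definition half x : set (circle R) :=
  [set z | 0 < cos (angle x) * cre z + sin (angle x) * cim z].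

Lemma half_open x : open (half x).
Proof.
pose g z := cos (angle x) * cre z + sin (angle x) * cim z.
have cg z : {for z, continuous g}.
  apply: contD; apply: contM; try exact: contC.
    exact: continuous_cre.
  exact: continuous_cim.
have -> : half x = g @^-1` [set t | 0 < t] by [].
have /continuousP : continuous g by [].
by apply; exact: open_gt.
Qed.

Lemma half_expi x y : half x (expi y) = (0 < cos (angle (y - x))) :> Prop.
Proof.
by rewrite /half /= cre_expi cim_expi /angle mulrBl cosB mulrC [sin _ * _]mulrC.
Qed.

Lemma half_sin x z : half x z ->
  -1 < cos (angle x) * cim z - sin (angle x) * cre z < 1.
Proof.
rewrite /half /=; set c := cos _; set s := sin _ => h.
have : (c * cre z + s * cim z) ^+ 2 + (c * cim z - s * cre z) ^+ 2 = 1.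
  transitivity ((c ^+ 2 + s ^+ 2) * (cre z ^+ 2 + cim z ^+ 2)); first by ring.
  by rewrite circle_norm cos2Dsin2 mulr1.
nra.
Qed.

Lemma continuous_branch x z : half x z -> {for z, continuous (branch x)}.
Proof.
move=> hz.
pose s z := cos (angle x) * cim z - sin (angle x) * cre z.
apply: (@contD _ _ (fun=> x) (fun z => asin (s z) / (pi *+ 2))).
  exact: contC.
apply: (@contM _ _ (fun z => asin (s z)) (fun=> _)); last exact: contC.
apply: (@continuous_comp _ _ _ s asin).
  apply: contB; apply: contM; try exact: contC.
    exact: continuous_cim.
  exact: continuous_cre.
by apply: continuous_asin; exact: half_sin.
Qed.

Lemma branchK x z : half x z -> expi (branch x z) = z.
Proof.
move=> hz; have hs := half_sin hz.
have p0 : pi *+ 2 != 0 :> R by rewrite mulr2n gt_eqF // addr_gt0 ?pi_gt0.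
have hs' : cos (angle x) * cim z - sin (angle x) * cre z \in `[(-1), 1]%R.
  by rewrite in_itv /=; case/andP: hs => /ltW -> /ltW ->.
have E : (cos (angle x) * cre z + sin (angle x) * cim z) ^+ 2 +
   (cos (angle x) * cim z - sin (angle x) * cre z) ^+ 2 = 1.
  transitivity ((cos (angle x) ^+ 2 + sin (angle x) ^+ 2) * (cre z ^+ 2 + cim z ^+ 2)).
    by ring.
  by rewrite circle_norm cos2Dsin2 mulr1.
have cE : cos (asin (cos (angle x) * cim z - sin (angle x) * cre z)) =
    cos (angle x) * cre z + sin (angle x) * cim z.
  rewrite cos_asin; last by move: hs'; rewrite in_itv.
  by rewrite -E addrK sqrtr_sqr gtr0_norm.
have aE : angle (branch x z) =
    angle x + asin (cos (angle x) * cim z - sin (angle x) * cre z).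
  by rewrite /branch {1}/angle mulrDl divfK.
have c1 := cos2Dsin2 (angle x).
apply: circle_eq; rewrite !(cre_expi, cim_expi) aE (cosD, sinD) cE asinK //.
  rewrite -[RHS]mul1r -c1; ring.
rewrite -[RHS]mul1r -c1; ring.
Qed.

Lemma half_self x : half x (expi x).
Proof. by rewrite half_expi subrr /angle mul0r cos0. Qed.

Lemma branch_expi x y : `|y - x| < 1 / 4 -> branch x (expi y) = y.
Proof.
move=> xy; rewrite /branch cre_expi cim_expi.
have p0 : 0 < pi *+ 2 :> R by rewrite mulr2n addr_gt0 ?pi_gt0.
have -> : cos (angle x) * sin (angle y) - sin (angle x) * cos (angle y) =
    sin (angle (y - x)) by rewrite /angle mulrBl sinB; ring.
rewrite sinK; first by rewrite /angle mulfK ?gt_eqF // addrC subrK.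
have a2 : `|angle (y - x)| <= pi / 2.
  rewrite /angle normrM (gtr0_norm p0).
  have -> : pi / 2 = 1 / 4 * (pi *+ 2) :> R by rewrite -mulr_natr; field.
  by rewrite ler_pM2r // ltW.
by rewrite in_itv /= -ler_norml.
Qed.

(** The half circles centred at the four quarter turns cover the circle, and [branch] provides a
    preimage on each. *)
Lemma expi_surj z : exists x, expi x = z.
Proof.
have [h|] := boolP (0 < cre z).
  exists (branch 0 z); apply: branchK.
  by rewrite /half /= /angle mul0r cos0 sin0 mul0r addr0 mul1r.
rewrite -leNgt le_eqVlt => /orP[/eqP z0|h]; last first.
  exists (branch (1 / 2) z); apply: branchK.
  rewrite /half /= /angle.
  have -> : (1 / 2) * (pi *+ 2) = pi :> R by rewrite -mulr_natr; field.
  by rewrite cospi sinpi mul0r addr0 mulN1r oppr_gt0.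
have := circle_norm z; rewrite z0 expr0n add0r => /eqP; rewrite sqrf_eq1.
move=> /orP[|] /eqP z1.
  exists (branch (1 / 4) z); apply: branchK.
  rewrite /half /= /angle.
  have -> : (1 / 4) * (pi *+ 2) = pi / 2 :> R by rewrite -mulr_natr; field.
  by rewrite cos_pihalf sin_pihalf z0 z1 mulr0 add0r mulr1.
exists (branch (- (1 / 4)) z); apply: branchK.
rewrite /half /= /angle.
have -> : (- (1 / 4)) * (pi *+ 2) = - (pi / 2) :> R by rewrite -mulr_natr; field.
by rewrite cosN sinN cos_pihalf sin_pihalf z0 z1 mulr0 add0r mulN1r opprK.
Qed.

End Circle.

(** * Lifting through coverings *)

Lemma near_continuous (X Y : topologicalType) (f g : X -> Y) (x : X) :
  (\forall w \near x, f w = g w) -> {for x, continuous f} ->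
  {for x, continuous g}.
Proof.
move=> fg cf A /= Ag.
have fgx : f x = g x := nbhs_singleton fg.
have : nbhs (f x) A by rewrite fgx.
by move=> /cf; apply: filterS2 fg => w /= ->.
Qed.

Lemma paste_continuous (X Y : topologicalType) (f g : X -> Y) (c : X -> bool) x :
  f x = g x -> {for x, continuous f} -> {for x, continuous g} ->
  {for x, continuous (fun w => if c w then f w else g w)}.
Proof.
move=> fgx cf cg A /= Ag.
have Af : nbhs (f x) A by move: Ag; case: (c x); rewrite ?fgx.
have {}Ag : nbhs (g x) A by rewrite -fgx.
have hf : \forall w \near x, A (f w) := cf _ Af.
have hg : \forall w \near x, A (g w) := cg _ Ag.
change (\forall w \near x, A (if c w then f w else g w)).
by apply: filterS2 hf hg => w; case: (c w).
Qed.

(** Phrased with neighbourhoods in the ambient space rather than in [C], since this is what local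
    sections and short segments provide. *)
Lemma connected_clopen (X : topologicalType) (C P : set X) x0 :
  connected C -> C x0 -> P x0 ->
  (forall x, C x -> P x -> \forall w \near x, P w) ->
  (forall x, C x -> ~ P x -> \forall w \near x, ~ P w) -> C `<=` P.
Proof.
move=> Cc Cx Px Po Pc.
suff : C `&` P = C by move=> <- x [].
apply: Cc; first by exists x0.
  exists (interior P); first exact: open_interior.
  apply/seteqP; split => [x [Cx' /(Po x Cx')]//|x [Cx' /interior_subset]//].
exists (~` interior (~` P)); first by apply: open_closedC; exact: open_interior.
apply/seteqP; split => [x [Cx' Px']|x [Cx' Px']]; split=> //.
  by move=> /interior_subset.
by apply: contrapT => /(Pc x Cx') h; exact: Px' h.
Qed.

Section Lifting.
Context (R : realType) (E B : topologicalType) (p : E -> B).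

(** The common part of the two coverings lifted through, [proj] and [f]. One [U] serves all points
    above it, which is what allows a lift to be prolonged; the sections are total functions,
    constrained only over [U]. *)
Definition locally_sectioned := forall b, exists U : set B,
  [/\ open U, U b & forall e, U (p e) -> exists q : B -> E,
    [/\ forall u, U u -> {for u, continuous q}, forall u, U u -> p (q u) = u &
      \forall e' \near e, q (p e') = e']].

Hypothesis pls : locally_sectioned.
Hypothesis haus : hausdorff_space E.

(** The coincidence set is open because [p] has a local left inverse, and closed because [E] is
    Hausdorff. *)
Lemma lift_unique (X : topologicalType) (L L' : X -> E) x0 :
  connected [set: X] -> continuous L -> continuous L' ->
  (forall x, p (L x) = p (L' x)) -> L x0 = L' x0 -> forall x, L x = L' x.
Proof.
move=> Xc cL cL' pLL' L0 x.
pose P := [set x | L x = L' x].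
suff : [set: X] `<=` P by apply.
apply: (connected_clopen (x0 := x0)) => // y _; rewrite /P /=.
  move=> Ly; have [U [Uo Uy]] := pls (p (L y)).
  move=> /(_ _ Uy) [q [_ _ qe]].
  have qe' : \forall e' \near L' y, q (p e') = e' by rewrite -Ly.
  have h : \forall w \near y, q (p (L w)) = L w := cL y _ qe.
  have : \forall w \near y, q (p (L' w)) = L' w := cL' y _ qe'.
  by apply: filterS2 h => w /= <- <-; rewrite pLL'.
move=> /eqP neq; have := haus; rewrite open_hausdorff => /(_ _ _ neq).
case=> -[A A'] /= [/set_mem Ay /set_mem A'y] [Ao A'o AA'].
have h : \forall w \near y, A (L w) := cL y _ (open_nbhs_nbhs (conj Ao Ay)).
have : \forall w \near y, A' (L' w) := cL' y _ (open_nbhs_nbhs (conj A'o A'y)).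
apply: filterS2 h => w /= Aw A'w Lw.
have : (A `&` A') (L w) by split; rewrite // Lw.
by rewrite (eqP AA').
Qed.

Section Homotopy.
Context (X : topologicalType) (G : X * R -> B) (e0 : X -> E).
Hypothesis Gc : continuous G.
Hypothesis e0c : continuous e0.
Hypothesis e0G : forall x, p (e0 x) = G (x, 0).

(** Time is truncated to [[0, s]], so that partial lifts are functions on all of [X * R] and no
    subspace topology enters. *)
Definition partial_lift (N : set X) (s : R) (L : X * R -> E) :=
  forall x, N x -> forall t, [/\ {for (x, t), continuous L},
    p (L (x, t)) = G (x, Num.max 0 (Num.min t s)) & t <= 0 -> L (x, t) = e0 x].

Definition liftable x0 s := exists (N : set X) L,
  [/\ open N, N x0 & partial_lift N s L].

Let cmin (s : R) (z : X * R) : {for z, continuous (fun w : X * R => (w.1, Num.min w.2 s))}.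
Proof.
apply: cont_pair; first exact: cvg_fst.
by apply: cont_min; [exact: cvg_snd|exact: contC].
Qed.

Lemma liftable0 x0 : liftable x0 0.
Proof.
exists setT, (fun w => e0 w.1); split => //; first exact: openT.
move=> x _ t; split => //.
- by apply: (@continuous_comp _ _ _ fst e0); [exact: cvg_fst|exact: e0c].
- by rewrite e0G max_l // ge_min lexx orbT.
Qed.

Lemma liftable_le x0 s s' : 0 <= s' <= s -> liftable x0 s -> liftable x0 s'.
Proof.
move=> /andP[s'0 s's] [N [L [No Nx0 NL]]].
exists N, (fun w => L (w.1, Num.min w.2 s')); split => // x Nx t.
have [Lc Lp L0] := NL x Nx (Num.min t s'); split.
- by apply: (@continuous_comp _ _ _ (fun w : X * R => (w.1, Num.min w.2 s')) L);
    [exact: cmin|exact: Lc].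
- by rewrite Lp -minA [Num.min s' s]min_l.
- by move=> t0; apply: L0; rewrite ge_min t0.
Qed.

(** Beyond time [s] the lift follows the section through [L (x0, s)]; the neighbourhood of [x0]
    shrinks to where both agree at time [s]. *)
Lemma liftable_extend x0 s s' (U : set B) (N1 : set X) : 0 <= s <= s' -> open U ->
  (forall e, U (p e) -> exists q : B -> E,
    [/\ forall u, U u -> {for u, continuous q}, forall u, U u -> p (q u) = u &
      \forall e' \near e, q (p e') = e']) ->
  open N1 -> N1 x0 -> (forall x t, N1 x -> s <= t <= s' -> U (G (x, t))) ->
  liftable x0 s -> liftable x0 s'.
Proof.
move=> /andP[s0 ss'] Uo Uq N1o N1x0 N1U [N [L [No Nx0 NL]]].
have ms : Num.max 0 (Num.min s s) = s by rewrite minxx max_r.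
have [Lc Lp _] := NL x0 Nx0 s.
have [|q [qc pq qe]] := Uq (L (x0, s)).
  by rewrite Lp ms; apply: N1U; rewrite // lexx ss'.
have near_q : \forall x \near x0, q (G (x, s)) = L (x, s).
  have : {for x0, continuous (fun x => L (x, s))}.
    apply: (@continuous_comp _ _ _ (fun x => (x, s)) L) => //.
    by apply: cont_pair; [exact: cvg_id|exact: cvg_cst].
  move=> cL; have h : \forall x \near x0, q (p (L (x, s))) = L (x, s) := cL _ qe.
  have NN : nbhs x0 N by exact: open_nbhs_nbhs.
  apply: filterS2 NN h => x Nx; have [_ -> _] := NL x Nx s.
  by rewrite ms.
pose N' := interior [set x | q (G (x, s)) = L (x, s)] `&` N `&` N1.
pose m (t : R) := Num.max s (Num.min t s').
pose L' (w : X * R) := if w.2 <= s then L w else q (G (w.1, m w.2)).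
exists N', L'; split.
- by apply: openI => //; apply: openI => //; exact: open_interior.
- by [].
move=> x [[/interior_subset /= qx Nx] N1x] t.
have Um r : U (G (x, m r)).
  by apply: N1U => //; rewrite /m le_max lexx /= ge_max ss' ge_min lexx orbT.
have [Lxc Lxp Lx0] := NL x Nx t.
have cr : {for (x, t), continuous (fun w : X * R => q (G (w.1, m w.2)))}.
  apply: (@continuous_comp _ _ _ (fun w : X * R => G (w.1, m w.2)) q); last first.
    exact: qc.
  apply: (@continuous_comp _ _ _ (fun w : X * R => (w.1, m w.2)) G); last exact: Gc.
  apply: cont_pair; first exact: cvg_fst.
  apply: cont_max; first exact: contC.
  by apply: cont_min; [exact: cvg_snd|exact: contC].
rewrite /L' /=; split.
- have [ts|ts|ts] := ltgtP t s.
  + apply: near_continuous Lxc.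
    have h : \forall w \near (x, t), w.2 < s.
      have c : {for (x, t), continuous (@snd X R)} by exact: cvg_snd.
      exact: (c _ (lt_nbhsl ts)).
    by apply: filterS h => w /= /ltW ->.
  + apply: near_continuous cr.
    have h : \forall w \near (x, t), s < w.2.
      have c : {for (x, t), continuous (@snd X R)} by exact: cvg_snd.
      exact: (c _ (lt_nbhsr ts)).
    by apply: filterS h => w /=; rewrite ltNge => /negbTE ->.
  + apply: paste_continuous => //=.
    by rewrite ts /m min_l // maxxx qx.
- case: ifP => ts.
    by rewrite Lxp !min_l // (le_trans ts).
  have st : s <= t by rewrite ltW // ltNge ts.
  rewrite pq // /m; congr (G (_, _)).
  have st' : s <= Num.min t s' by rewrite le_min st.
  by rewrite !max_r // (le_trans s0).
- by move=> t0; rewrite (le_trans t0 s0) Lx0.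
Qed.

(** If some time were out of reach, let [r] be the supremum of the liftable ones: a sectioned
    neighbourhood of [G (x0, r)] carries a lift from a time just before [r] to one just after. *)
Lemma liftable_all x0 s : 0 <= s -> liftable x0 s.
Proof.
move=> s0; apply: contrapT => ns.
pose S := [set r | 0 <= r /\ liftable x0 r].
have S0 : S 0 by split; rewrite ?lexx //; exact: liftable0.
have Ss : ubound S s.
  move=> r [r0 rl]; rewrite leNgt; apply/negP => sr; apply: ns.
  by apply: liftable_le rl; rewrite s0 ltW.
have hS : has_sup S by split; [exists 0|exists s].
pose r := sup S.
have r0 : 0 <= r by apply: sup_upper_bound.
have [U [Uo Ub Uq]] := pls (G (x0, r)).
have := Gc (open_nbhs_nbhs (conj Uo Ub)).
case=> -[A1 A2] /= [A1x A2r] A12.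
have /nbhs_ballP[e /= e_gt0 eA2] := A2r.
have [r1 [r10 r1l] r1e] := sup_adherent e_gt0 hS.
have r1r : r1 <= r by apply: sup_upper_bound.
have {}r1e : r - e < r1 := r1e.
have {}e_gt0 : 0 < e := e_gt0.
have : S (r + e / 2).
  split; first by rewrite addr_ge0 // divr_ge0 // ltW.
  apply: (liftable_extend _ Uo Uq (N1 := interior A1)) r1l => //.
  - by rewrite r10 /=; apply: le_trans r1r _; rewrite lerDl divr_ge0 // ltW.
  - exact: open_interior.
  - move=> x t /interior_subset A1x' /andP[t1 t2]; apply: A12; split => //=.
    apply: eA2; rewrite /ball /= ltr_norml; apply/andP; split; lra.
move=> /(sup_upper_bound hS); rewrite -/r; lra.
Qed.

(** Uniqueness along the time line through [x], on which both lifts start from [e0 x]; this makes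
    the local lifts glue. *)
Lemma partial_lift_unique (N N' : set X) s s' L L' x t :
  partial_lift N s L -> partial_lift N' s' L' -> N x -> N' x ->
  t <= s -> t <= s' -> L (x, t) = L' (x, t).
Proof.
move=> NL NL' Nx N'x ts ts'.
pose l (M : X * R -> E) r := M (x, Num.min r t).
have lc (M : X * R -> E) : (forall r, {for (x, r), continuous M}) -> continuous (l M).
  move=> Mc r; apply: (@continuous_comp _ _ _ (fun r => (x, Num.min r t)) M).
    apply: cont_pair; first exact: cvg_cst.
    by apply: cont_min; [exact: cvg_id|exact: contC].
  exact: Mc.
have -> : L (x, t) = l L t by rewrite /l minxx.
have -> : L' (x, t) = l L' t by rewrite /l minxx.
apply: (lift_unique (x0 := Num.min t 0)).
- by apply/connected_intervalP => a b _ _ c _.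
- by apply: lc => r; have [] := NL x Nx r.
- by apply: lc => r; have [] := NL' x N'x r.
- move=> r; rewrite /l.
  have [_ -> _] := NL x Nx (Num.min r t); have [_ -> _] := NL' x N'x (Num.min r t).
  by rewrite -!minA ![Num.min t _]min_l.
- rewrite /l; set r := Num.min _ t.
  have r0 : r <= 0 by rewrite /r !ge_min lexx !orbT.
  have [_ _ ->] := NL x Nx r => //; have [_ _ ->] := NL' x N'x r => //.
Qed.

Lemma homotopy_lift : exists L : X * R -> E, [/\ continuous L,
  forall x t, p (L (x, t)) = G (x, Num.max 0 t) & forall x, L (x, 0) = e0 x].
Proof.
(* The margin [1] keeps the lift chosen for [t] valid at all nearby times, whence continuity at
   [(x, t)]. *)
have ex (x : X) (t : R) : exists NL : set X * (X * R -> E),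
    [/\ open NL.1, NL.1 x & partial_lift NL.1 (`|t| + 1) NL.2].
  have [|N [L ?]] := @liftable_all x (`|t| + 1); last by exists (N, L).
  by rewrite addr_ge0.
pose NL x t := proj1_sig (cid (ex x t)).
have NLP x t : [/\ open (NL x t).1, (NL x t).1 x &
    partial_lift (NL x t).1 (`|t| + 1) (NL x t).2] := proj2_sig (cid (ex x t)).
exists (fun w => (NL w.1 w.2).2 w); split.
- move=> [x t].
  have [No Nx NL1] := NLP x t.
  have [Lc _ _] := NL1 x Nx t.
  apply: near_continuous Lc.
  have h1 : \forall w \near (x, t), (NL x t).1 w.1.
    have c : {for (x, t), continuous (@fst X R)} by exact: cvg_fst.
    by apply: (c _ (open_nbhs_nbhs _)).
  have h2 : \forall w \near (x, t), w.2 < `|t| + 1.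
    have c : {for (x, t), continuous (@snd X R)} by exact: cvg_snd.
    by apply: (c _ (lt_nbhsl _)); rewrite ltr_pwDr // ler_norm.
  apply: filterS2 h1 h2 => -[x' t'] /= Nx' t't.
  have [_ Nx2 NL2] := NLP x' t'.
  apply: (partial_lift_unique NL1 NL2) => //; first exact: ltW.
  by rewrite ler_wpDr // ler_norm.
- move=> x t /=; have [No Nx NL1] := NLP x t.
  have [_ -> _] := NL1 x Nx t.
  by rewrite [Num.min _ _]min_l // ler_wpDr // ler_norm.
- move=> x /=; have [No Nx NL1] := NLP x 0.
  by have [_ _ ->] := NL1 x Nx 0.
Qed.

End Homotopy.

(** The plane contracts to the origin: the homotopy [(v, t) |-> g (t v)] starts from a constant,
    lifted by [e], and its lift at time [1] is a lift of [g]. *)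
Lemma lift_plane (g : R * R -> B) (e : E) : continuous g -> p e = g (0, 0) ->
  exists L : R * R -> E,
    [/\ continuous L, forall v, p (L v) = g v & L (0, 0) = e].
Proof.
move=> gc eg.
pose S (w : (R * R) * R) := (w.2 * w.1.1, w.2 * w.1.2).
pose G w := g (S w).
have Sc : continuous S.
  move=> w.
  have c2 : {for w, continuous (@snd (R * R) R)} by exact: cvg_snd.
  have c11 : {for w, continuous (fun w : (R * R) * R => w.1.1)}.
    by apply: (@continuous_comp _ _ _ fst fst); exact: cvg_fst.
  have c12 : {for w, continuous (fun w : (R * R) * R => w.1.2)}.
    by apply: (@continuous_comp _ _ _ fst snd); [exact: cvg_fst|exact: cvg_snd].
  exact: (cont_pair (contM c2 c11) (contM c2 c12)).
have Gc : continuous G.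
  by move=> w; apply: (@continuous_comp _ _ _ S g); [exact: Sc|exact: gc].
have ec : continuous (fun _ : R * R => e) by move=> x; exact: cvg_cst.
have eG x : p e = G (x, 0) by rewrite /G /S /= !mul0r.
have [L [Lc Lp L0]] := homotopy_lift Gc ec eG.
have c1 (r : R) : continuous (fun x : R * R => (x, r)).
  by move=> x; apply: cont_pair; [exact: cvg_id|exact: cvg_cst].
exists (fun x => L (x, 1)); split.
- move=> x; apply: (@continuous_comp _ _ _ (fun x : R * R => (x, 1 : R)) L).
    exact: c1.
  exact: Lc.
- by move=> [a b]; rewrite Lp max_r // /G /S /= !mul1r.
(* Over the origin the homotopy is a constant path, so its lift does not move between times [0] and
   [1]. *)
rewrite -[RHS](L0 (0, 0)).
pose z : R * R := (0, 0).
apply: (@lift_unique R (fun t => L (z, t)) (fun t => L (z, 0)) 0) => //.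
- by apply/connected_intervalP => a b _ _ c _.
- move=> t; apply: (@continuous_comp _ _ _ (fun t : R => (z, t)) L); last exact: Lc.
  by apply: cont_pair; [exact: cvg_cst|exact: cvg_id].
- by move=> t; exact: cvg_cst.
- by move=> t; rewrite !Lp /G /S /= !mulr0.
Qed.

End Lifting.

(** * The universal covering of the annulus *)

Lemma hausdorff_inj (X Y : topologicalType) (f : X -> Y) :
  continuous f -> injective f -> hausdorff_space Y -> hausdorff_space X.
Proof.
move=> fc fi Yh x x' xx'; apply: fi; apply: Yh => A B /fc Ax /fc Bx'.
have [z [Az Bz]] := xx' _ _ Ax Bx'.
by exists (f z).
Qed.

Lemma covering_locally_sectioned (X Y : topologicalType) (f : X -> Y) :
  covering_map f -> locally_sectioned f.
Proof.
move=> [_ _ fU] b; have [U [Uo Ub [I [V [Vo _ fV Vh]]]]] := fU b.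
exists U; split => // e Ue.
have : (f @^-1` U) e by [].
rewrite fV => -[i _ Vie].
have [[fiU finj fsurj] _ [g gc gK]] := Vh i.
have gK' x : V i x -> g (f x) = x by move=> Vx; apply: gK; exact: mem_set.
exists g; split.
- move=> u Uu; move: gc; rewrite continuous_open_subspace // => /(_ u).
  by apply; exact: mem_set.
- by move=> u /fsurj[x Vx <-]; rewrite gK'.
- have : nbhs e (V i) by exact: open_nbhs_nbhs.
  by apply: filterS => e' /gK'.
Qed.

Section Annulus.
Context (R : realType).
Implicit Types (v w : R * R) (a : annulus R) (n : int).

(** The logistic function, an increasing homeomorphism from the line onto []0, 1[], with inverse
    [rho_inv]; it lets the whole plane cover the annulus. *)
Definition rho (x : R) : R := (1 + expR (- x))^-1.
Definition rho_inv (u : R) : R := - ln (u^-1 - 1).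

Lemma rho_gt0 x : 0 < rho x.
Proof. by rewrite invr_gt0 addr_gt0 // expR_gt0. Qed.

Lemma rho_itv x : open_interval R (rho x).
Proof.
rewrite /open_interval /= in_itv /= rho_gt0 /= invf_lt1.
  by rewrite ltrDl expR_gt0.
by rewrite addr_gt0 // expR_gt0.
Qed.

Lemma rhoK : cancel rho rho_inv.
Proof. by move=> x; rewrite /rho_inv invrK addrC addKr expRK opprK. Qed.

Lemma rho_invK u : 0 < u < 1 -> rho (rho_inv u) = u.
Proof.
move=> /andP[u0 u1]; rewrite /rho /rho_inv opprK lnK ?subrKC ?invrK //.
by rewrite posrE subr_gt0 invf_gt1.
Qed.

Lemma ltr_rho x y : (rho x < rho y) = (x < y).
Proof.
rewrite ltf_pV2 ?posrE ?addr_gt0 ?expR_gt0 // ltrD2l ltr_expR.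
by rewrite ltrN2.
Qed.

Lemma continuous_rho : continuous rho.
Proof.
move=> x; apply: (@contV _ _ (fun x => 1 + expR (- x))).
  by rewrite gt_eqF // addr_gt0 // expR_gt0.
apply: (@contD _ _ (fun=> 1) (fun x => expR (- x))); first exact: contC.
apply: cont_comp; first exact: continuous_expR.
exact: opp_continuous.
Qed.

Lemma continuous_rho_inv u : 0 < u < 1 -> {for u, continuous rho_inv}.
Proof.
move=> /andP[u0 u1].
have c1 : {for u, continuous (fun u : R => u^-1 - 1)}.
  apply: contB; last exact: contC.
  by apply: contV; [rewrite gt_eqF|exact: cvg_id].
have c2 : {for u, continuous (fun u : R => ln (u^-1 - 1))}.
  apply: (@continuous_comp _ _ _ (fun u : R => u^-1 - 1) (@ln R)) => //.
  by apply: continuous_ln; rewrite subr_gt0 invf_gt1.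
exact: (cvgN c2).
Qed.

Definition proj v : annulus R := (SigSub (mem_set (rho_itv v.1)), expi v.2).

Definition height a : R := rho_inv (set_val a.1).

(** The deck transformations. The angular coordinate comes second: lifted connectors run from left
    to right and their translates are stacked vertically. *)
Definition shift n v : R * R := (v.1, v.2 + n%:~R).

Lemma annulus_itv a : 0 < set_val a.1 < 1.
Proof. by have := set_valP a.1; rewrite /open_interval /= in_itv. Qed.

Lemma continuous_proj : continuous proj.
Proof.
move=> v; apply: (@cont_pair _ _ _ (fun v => SigSub (mem_set (rho_itv v.1)) : open_interval R)
  (fun v => expi v.2)).
  apply: (@continuous_comp_initial _ _ _ set_val).
  move=> w; apply: (@continuous_comp _ _ _ fst rho); first exact: cvg_fst.
  exact: continuous_rho.
by apply: (@continuous_comp _ _ _ snd (@expi R)); [exact: cvg_snd|exact: continuous_expi].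
Qed.

Lemma continuous_height : continuous height.
Proof.
move=> a; apply: (@continuous_comp _ R _ (fun a : annulus R => set_val a.1) rho_inv).
  apply: (@continuous_comp _ _ R fst set_val); first exact: cvg_fst.
  exact: initial_continuous.
by apply: continuous_rho_inv; exact: annulus_itv.
Qed.

Lemma height_proj v : height (proj v) = v.1.
Proof. by rewrite /height /= rhoK. Qed.

Lemma rho_height a : rho (height a) = set_val a.1.
Proof. by apply: rho_invK; exact: annulus_itv. Qed.

Lemma projE a y : expi y = a.2 -> proj (height a, y) = a.
Proof.
case: a => u z /= yz; congr pair => //=.
by apply: val_inj => /=; rewrite (rho_height (u, z)).
Qed.

Lemma proj_surj a : exists v, proj v = a.
Proof. by have [y /projE] := expi_surj a.2; exists (height a, y). Qed.

Lemma proj_shift n v : proj (shift n v) = proj v.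
Proof. by rewrite /proj /= expiDz. Qed.

Lemma proj_inj v w : proj v = proj w -> exists n, w = shift n v.
Proof.
move=> E; have := congr1 height E; rewrite !height_proj => E1.
have /expi_inj[n nE] : expi v.2 = expi w.2 := congr1 snd E.
by exists n; rewrite /shift -nE E1; case: (w).
Qed.

Lemma shiftD m n v : shift m (shift n v) = shift (n + m) v.
Proof. by rewrite /shift /= intrD addrA. Qed.

Lemma shift0 v : shift 0 v = v.
Proof. by rewrite /shift addr0; case: v. Qed.

Lemma shiftK n v : shift (- n) (shift n v) = v.
Proof. by rewrite shiftD subrr shift0. Qed.

Lemma shiftNK n v : shift n (shift (- n) v) = v.
Proof. by rewrite shiftD addNr shift0. Qed.

Lemma continuous_shift n : continuous (shift n).
Proof.
move=> v; apply: cont_pair; first exact: cvg_fst.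
by apply: contD; [exact: cvg_snd|exact: contC].
Qed.

Definition section (y : R) a : R * R := (height a, branch y a.2).

Lemma continuous_section y a : half y a.2 -> {for a, continuous (section y)}.
Proof.
move=> ha; apply: cont_pair; first exact: continuous_height.
apply: (@continuous_comp _ _ _ snd (branch y)); first exact: cvg_snd.
exact: continuous_branch.
Qed.

Lemma sectionK y a : half y a.2 -> proj (section y a) = a.
Proof. by move=> ha; apply: projE; exact: branchK. Qed.

Lemma continuous_half (y : R) : open [set a : annulus R | half y a.2].
Proof.
have /continuousP : continuous (snd : annulus R -> circle R) by move=> a; exact: cvg_snd.
by apply; exact: half_open.
Qed.

Lemma near_int_eq0 (X : topologicalType) (u : X -> R) (x : X) :
  (forall z, exists n : int, u z = n%:~R) -> {for x, continuous u} -> u x = 0 ->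
  \forall z \near x, u z = 0.
Proof.
move=> ui uc u0.
have /cvgrPdist_lt/(_ 1 ltr01) := uc.
apply: filterS => z; rewrite u0 sub0r normrN; have [n ->] := ui z.
by rewrite -intr_norm ltrz1 => n1; have -> : n = 0 by lia.
Qed.

(** The section through [e] is a shifted [section]; near [e], the second coordinates of [q (proj w)]
    and [w] differ by a continuous integer that vanishes at [e]. *)
Lemma proj_locally_sectioned : locally_sectioned proj.
Proof.
move=> b; have [v vb] := proj_surj b.
exists [set a | half v.2 a.2]; split.
- exact: continuous_half.
- by rewrite -vb; exact: half_self.
move=> e he; have /sectionK/proj_inj [n nE] := he.
pose q a := shift n (section v.2 a).
have qc u : half v.2 u.2 -> {for u, continuous q}.
  move=> hu; apply: (@continuous_comp _ _ _ (section v.2) (shift n)).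
    exact: continuous_section.
  exact: continuous_shift.
exists q; split => //.
- by move=> u hu; rewrite proj_shift sectionK.
- pose u w := (q (proj w)).2 - w.2.
  (* truncate away from the half circle, where [q] is not a section *)
  pose u' w := if `[< half v.2 (proj w).2 >] then u w else 0.
  have Uo : \forall w \near e, half v.2 (proj w).2.
    have U0 : nbhs (proj e) [set a | half v.2 a.2].
      by apply: open_nbhs_nbhs; split => //; exact: continuous_half.
    exact: (continuous_proj U0).
  have : \forall w \near e, u' w = 0.
    apply: near_int_eq0.
    + move=> w; rewrite /u' /u; case: asboolP => [h|_]; last by exists 0.
      have : proj w = proj (q (proj w)) by rewrite proj_shift sectionK.
      by move=> /proj_inj[m ->]; exists m; rewrite /= addrC addKr.
    + apply: (@near_continuous _ _ u).
        by apply: filterS Uo => w h; rewrite /u'; case: asboolP.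
      apply: contB; last exact: cvg_snd.
      apply: (@continuous_comp _ _ _ (q \o proj) snd); last exact: cvg_snd.
      by apply: continuous_comp; [exact: continuous_proj|exact: qc].
    + rewrite /u'; case: asboolP => // _.
      by rewrite /u /q -nE subrr.
  apply: filterS2 Uo => w h; rewrite /u'; case: asboolP => // _ /eqP.
  rewrite subr_eq0 => /eqP E.
  have q1 : (q (proj w)).1 = w.1 by rewrite /q /= height_proj.
  by rewrite [LHS]surjective_pairing q1 E -surjective_pairing.
Qed.

Lemma plane_hausdorff : hausdorff_space (R * R)%type.
Proof. exact: norm_hausdorff. Qed.

Lemma annulus_hausdorff : hausdorff_space (annulus R).
Proof.
apply: (@hausdorff_inj _ (R * (R * R))%type
  (fun a : annulus R => (height a, (cre a.2, cim a.2)))).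
- move=> a; apply: cont_pair; first exact: continuous_height.
  apply: cont_pair.
    apply: (@continuous_comp _ _ _ snd (@cre R)); first exact: cvg_snd.
    exact: continuous_cre.
  apply: (@continuous_comp _ _ _ snd (@cim R)); first exact: cvg_snd.
  exact: continuous_cim.
- move=> a b [hab cab sab].
  have [y ya] := expi_surj a.2; rewrite -(projE ya) hab.
  by apply: projE; rewrite ya; apply: circle_eq.
- exact: norm_hausdorff.
Qed.

Lemma lift_proj (g : R * R -> annulus R) e : continuous g -> proj e = g (0, 0) ->
  exists L : R * R -> R * R,
    [/\ continuous L, forall v, proj (L v) = g v & L (0, 0) = e].
Proof. exact: (lift_plane proj_locally_sectioned plane_hausdorff). Qed.

Lemma lift_proj_unique (X : topologicalType) (L L' : X -> R * R) :
  connected [set: X] -> continuous L -> continuous L' ->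
  (forall x, proj (L x) = proj (L' x)) -> exists n, forall x, L' x = shift n (L x).
Proof.
move=> Xc Lc L'c LL'.
have [[x0 _]|noX] := pselect ([set: X] !=set0); last first.
  by exists 0 => x; exfalso; apply: noX; exists x.
have /proj_inj[n nE] := LL' x0; exists n => x.
apply: (lift_unique proj_locally_sectioned plane_hausdorff (L := L')
  (L' := fun y => shift n (L y)) (x0 := x0)) => //.
  move=> y; apply: (@continuous_comp _ _ _ L (shift n)); first exact: Lc.
  exact: continuous_shift.
by move=> y; rewrite proj_shift LL'.
Qed.

End Annulus.

(** * Singular simplices of dimension at most two *)

Section Simplices.
Context (R : realType) (X : topologicalType).

Lemma mx_continuous (Y : topologicalType) n (f : Y -> 'rV[R]_n) y :
  (forall j, {for y, continuous (fun u => f u 0 j)}) -> {for y, continuous f}.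
Proof.
move=> fc P /= [Q Qt QP].
have Qij i j : \forall u \near y, Q i j (f u i j).
  by rewrite ord1; exact: fc.
apply: filterS (@filter_forall _ _ _ _ _
  (fun k => @filter_forall _ _ _ _ _ (Qij k))) => u Qu.
by apply: QP => k j; exact: Qu.
Qed.

Definition simplex_coord n (j : 'I_n.+1) (t : std_simplex R n) : R :=
  (set_val t : 'rV[R]_n.+1) 0 j.

Lemma continuous_simplex_coord n (j : 'I_n.+1) : continuous (@simplex_coord n j).
Proof.
move=> t; apply: (@continuous_comp _ 'rV[R]_n.+1 R set_val (fun v => v 0 j)).
  exact: initial_continuous.
exact: coord_continuous.
Qed.

Lemma continuous_coord1 : continuous (@simplex_coord 1 (inord 1)).
Proof. exact: continuous_simplex_coord. Qed.

Lemma continuous_coord2 :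
  continuous (fun t => (@simplex_coord 2 (inord 1) t, @simplex_coord 2 (inord 2) t)).
Proof. by move=> t; apply: cont_pair; exact: continuous_simplex_coord. Qed.

(** Simplices are restrictions of maps on the whole line or plane, read through the last barycentric
    coordinates. Every simplex of dimension one or two arises so, by [sx1_surj] and [sx2_surj]. *)
Definition sx1 (g : continuousType R X) : singular_simplex R X 1 :=
  g \o mkcts continuous_coord1.

Definition sx2 (g : continuousType (R * R)%type X) : singular_simplex R X 2 :=
  g \o mkcts continuous_coord2.

Definition sx0 (x : X) : singular_simplex R X 0 := cst x.

Lemma simplex_coord_itv n (j : 'I_n.+1) t : 0 <= @simplex_coord n j t <= 1.
Proof.
rewrite /simplex_coord; have [t0 t1] := set_valP t; rewrite t0 /=.
rewrite -t1 (bigD1 j) //= lerDl sumr_ge0 // => i _.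
Qed.

Lemma eq_sx1 (g g' : continuousType R X) :
  (forall u, 0 <= u <= 1 -> g u = g' u) -> sx1 g = sx1 g'.
Proof. by move=> gg'; apply/continuousEP => t; apply: gg'; exact: simplex_coord_itv. Qed.

Lemma coord_face n (i : 'I_n.+2) (j : 'I_n.+2) (t : std_simplex R n) :
  simplex_coord j (face i t) = oapp (fun k => simplex_coord k t) 0 (unlift i j).
Proof. by rewrite /simplex_coord /= mxE. Qed.

Lemma unlift_lift n (i j : 'I_n.+2) (k : 'I_n.+1) :
  nat_of_ord j = bump i k -> unlift i j = Some k.
Proof.
move=> jE; have -> : j = fintype.lift i k by apply: val_inj; exact: jE.
by rewrite liftK.
Qed.

Lemma coord_sum1 (t : std_simplex R 1) :
  simplex_coord (inord 0) t = 1 - simplex_coord (inord 1) t.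
Proof.
rewrite /simplex_coord; have [_ <-] := set_valP t.
rewrite big_ord_recl big_ord1.
have -> : inord 0 = ord0 :> 'I_2 by apply: val_inj; rewrite /= inordK.
have -> : inord 1 = fintype.lift ord0 ord0 :> 'I_2 by apply: val_inj; rewrite /= inordK.
by rewrite addrK.
Qed.

Lemma bdry_sx1 (g : continuousType R X) :
  bdry << sx1 g >> = << sx0 (g 1) >> - << sx0 (g 0) >> :> chain R X 0.
Proof.
rewrite bdryU /simplex_bdry big_ord_recl big_ord1 expr0 /= expr1 -freegUN.
have c1 (t : std_simplex R 0) : simplex_coord ord0 t = 1.
  by rewrite /simplex_coord; have [_] := set_valP t; rewrite big_ord1.
congr (<< _ >> - << _ >>); apply/continuousEP => t /=; rewrite /mkcts coord_face.
  by rewrite (@unlift_lift _ _ _ ord0) ?inordK //= c1.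
have -> : inord 1 = fintype.lift ord0 ord0 :> 'I_2 by apply: val_inj; rewrite /= inordK.
by rewrite unlift_none.
Qed.

Lemma bdry_sx2 (g : continuousType (R * R)%type X) (e0 e1 e2 : continuousType R X) :
  (forall u, e0 u = g (1 - u, u)) -> (forall u, e1 u = g (0, u)) ->
  (forall u, e2 u = g (u, 0)) ->
  bdry << sx2 g >> = << sx1 e0 >> - << sx1 e1 >> + << sx1 e2 >> :> chain R X 1.
Proof.
move=> E0 E1 E2.
rewrite bdryU /simplex_bdry !big_ord_recl big_ord0 addr0 expr0 /= expr1.
rewrite sqrrN expr1n -freegUN addrA.
have i0 : ord0 = inord 0 :> 'I_2 by apply: val_inj; rewrite /= inordK.
have i1 : fintype.lift ord0 ord0 = inord 1 :> 'I_2 by apply: val_inj; rewrite /= inordK.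
congr (<< _ >> - << _ >> + << _ >>); apply/continuousEP => t /=;
  rewrite /mkcts !coord_face.
- rewrite (@unlift_lift _ _ _ (inord 0)) ?inordK //=.
  by rewrite (@unlift_lift _ _ _ (inord 1)) ?inordK //= E0 coord_sum1.
- rewrite (_ : inord 1 = fintype.lift ord0 ord0); last by apply: val_inj; rewrite /= inordK.
  rewrite unlift_none /= E1.
  by rewrite (@unlift_lift _ _ _ (inord 1)) ?inordK.
- rewrite (@unlift_lift _ _ (inord 1) (inord 1)) ?inordK //=.
  rewrite (_ : inord 2 = fintype.lift ord0 (fintype.lift ord0 ord0)); last by apply: val_inj; rewrite /= inordK.
  by rewrite unlift_none /= E2.
Qed.

Lemma point0_subproof : std_simplex R 0 (const_mx 1).
Proof. by split => [i|]; rewrite ?big_ord1 !mxE. Qed.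

Definition point0 : std_simplex R 0 := SigSub (mem_set point0_subproof).

Definition clamp (u : R) : R := Num.max 0 (Num.min u 1).

Lemma clamp_itv u : 0 <= clamp u <= 1.
Proof. by rewrite /clamp le_max lexx /= ge_max ler01 ge_min lexx orbT. Qed.

Lemma clamp_id u : 0 <= u <= 1 -> clamp u = u.
Proof. by move=> /andP[u0 u1]; rewrite /clamp min_l // max_r. Qed.

Lemma continuous_clamp : continuous clamp.
Proof.
move=> u.
have c : {for u, continuous (fun u : R => Num.max 0 (Num.min u 1))}.
  apply: cont_max; first exact: contC.
  by apply: cont_min; [exact: cvg_id|exact: contC].
exact: c.
Qed.

Lemma coord1_section : exists r : R -> std_simplex R 1,
  continuous r /\ forall u, simplex_coord (inord 1) (r u) = clamp u.
Proof.
pose r (u : R) : 'rV[R]_2 := \row_j (if j == inord 1 then clamp u else 1 - clamp u).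
have rP u : std_simplex R 1 (r u).
  have /andP[c0 c1] := clamp_itv u; split => [j|].
    by rewrite mxE; case: ifP => // _; rewrite subr_ge0.
  rewrite big_ord_recl big_ord1 !mxE.
  have -> : (ord0 == inord 1 :> 'I_2) = false by apply/eqP => /(congr1 val); rewrite /= inordK.
  have -> : (fintype.lift ord0 ord0 == inord 1 :> 'I_2) = true.
    by apply/eqP/val_inj; rewrite /= inordK.
  by rewrite subrK.
exists (fun u => SigSub (mem_set (rP u))); split; last first.
  by move=> u; rewrite /simplex_coord /= mxE eqxx.
apply: (@continuous_comp_initial _ _ _ set_val).
move=> u; apply: mx_continuous => j.
rewrite [X in {for u, continuous X}](_ : _ =
  (fun u => if j == inord 1 then clamp u else 1 - clamp u)); last first.
  by apply/funext => w; rewrite /= mxE.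
case: (j == inord 1); first exact: continuous_clamp.
by apply: contB; [exact: contC|exact: continuous_clamp].
Qed.

Lemma coord1_inj (t t' : std_simplex R 1) :
  simplex_coord (inord 1) t = simplex_coord (inord 1) t' -> t = t'.
Proof.
move=> tt'; apply: val_inj; apply/rowP => j.
have [->//|jn1] := eqVneq j (inord 1).
have -> : j = inord 0.
  apply: val_inj => /=; rewrite inordK //.
  case: j jn1 => [[|[|]]] //= p /eqP j1; exfalso; apply: j1.
  by apply: val_inj; rewrite /= inordK.
by have := coord_sum1 t; rewrite tt' -coord_sum1.
Qed.

Lemma sx1_surj (s : singular_simplex R X 1) : exists g, s = sx1 g.
Proof.
have [r [rc rE]] := coord1_section.
exists (s \o mkcts rc); apply/continuousEP => t /=; congr (s _).
by apply: coord1_inj; rewrite rE clamp_id // simplex_coord_itv.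
Qed.

Lemma sx1_inj (g g' : continuousType R X) : sx1 g = sx1 g' ->
  forall u, 0 <= u <= 1 -> g u = g' u.
Proof.
move=> gg' u u01; have [r [_ rE]] := coord1_section.
have : sx1 g (r u) = sx1 g' (r u) by rewrite gg'.
by rewrite /= /mkcts rE clamp_id.
Qed.

(** The plane retracts onto the triangle by clamping [x] and then cutting the clamped [y] at
    [1 - x]; the simplex is extended along this retraction. *)
Lemma sx2_surj (s : singular_simplex R X 2) : exists g, s = sx2 g.
Proof.
pose x (v : R * R) := clamp v.1.
pose y (v : R * R) := Num.min (clamp v.2) (1 - x v).
pose e (v : R * R) (j : 'I_3) :=
  if j == inord 1 then x v else if j == inord 2 then y v else 1 - x v - y v.
pose r v : 'rV[R]_3 := \row_j e v j.
have j01 : (ord0 == inord 1 :> 'I_3) = false by apply/eqP => /(congr1 val); rewrite /= inordK.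
have j02 : (ord0 == inord 2 :> 'I_3) = false by apply/eqP => /(congr1 val); rewrite /= inordK.
have j1 : fintype.lift ord0 ord0 = inord 1 :> 'I_3 by apply: val_inj; rewrite /= inordK.
have j2 : fintype.lift ord0 (fintype.lift ord0 ord0) = inord 2 :> 'I_3.
  by apply: val_inj; rewrite /= inordK.
have j21 : (inord 2 == inord 1 :> 'I_3) = false.
  by apply/eqP => /(congr1 val); rewrite /= !inordK.
have rP v : std_simplex R 2 (r v).
  have /andP[x0 x1] := clamp_itv v.1; have /andP[y0 y1] := clamp_itv v.2.
  split => [j|].
    rewrite mxE /e /y /x; case: ifP => // _; case: ifP => _.
      by rewrite le_min y0 subr_ge0.
    by rewrite subr_ge0 ge_min lexx orbT.
  rewrite !big_ord_recl big_ord0 !mxE /e j1 j2 j01 j02 j21 !eqxx; ring.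
pose r' v : std_simplex R 2 := SigSub (mem_set (rP v)).
have xc v : {for v, continuous x}.
  by apply: (@continuous_comp _ _ _ fst clamp); [exact: cvg_fst|exact: continuous_clamp].
have yc v : {for v, continuous y}.
  apply: (@cont_min _ _ (fun v => clamp v.2) (fun v => 1 - x v)).
    by apply: (@continuous_comp _ _ _ snd clamp); [exact: cvg_snd|exact: continuous_clamp].
  by apply: contB; [exact: contC|exact: xc].
have r'c : continuous r'.
  apply: (@continuous_comp_initial _ _ _ set_val).
  move=> v; apply: mx_continuous => j.
  have -> : (fun v => ((set_val \o r') v : 'rV[R]_3) 0 j) = (fun v => e v j).
    by apply/funext => w; rewrite /= mxE.
  rewrite /e; case: (j == inord 1); first exact: xc.
  case: (j == inord 2); first exact: yc.
  apply: (@contB _ _ (fun v => 1 - x v) y); last exact: yc.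
  by apply: (@contB _ _ (fun=> 1) x); [exact: contC|exact: xc].
exists (s \o mkcts r'c); apply/continuousEP => t /=; congr (s _).
have tsum : simplex_coord ord0 t + (simplex_coord (inord 1) t + simplex_coord (inord 2) t) = 1.
  rewrite /simplex_coord; have [_ <-] := set_valP t.
  by rewrite !big_ord_recl big_ord0 addr0 j1 j2.
have t0 : 0 <= simplex_coord ord0 t by case/andP: (simplex_coord_itv ord0 t).
have yE : y (simplex_coord (inord 1) t, simplex_coord (inord 2) t) = simplex_coord (inord 2) t.
  rewrite /y /x /= !clamp_id ?simplex_coord_itv // min_l //.
  have le (a b c : R) : a + (b + c) = 1 -> 0 <= a -> c <= 1 - b by lra.
  exact: le tsum t0.
apply: val_inj; apply/rowP => j /=; rewrite mxE /mkcts /e yE /x /= clamp_id ?simplex_coord_itv //.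
case: ifP => [/eqP -> //|/eqP jn1]; case: ifP => [/eqP -> //|/eqP jn2].
apply/esym; transitivity (simplex_coord ord0 t).
  have eq (a b c : R) : a + (b + c) = 1 -> 1 - b - c = a by lra.
  by rewrite /mkcts /=; exact: eq tsum.
rewrite /simplex_coord; congr (_ 0 _); apply: val_inj => /=.
case: j jn1 jn2 => [[|[|[|]]]] //= p jn1 jn2; exfalso; [apply: jn1|apply: jn2];
  by apply: val_inj; rewrite /= inordK.
Qed.

End Simplices.

Section Homologous.
Context (R : realType) (X : topologicalType).
Implicit Types c : chain R X 1.

(** Stated for all chains, not only cycles, so that computations can be made on one simplex at a
    time. *)
Definition homologous c c' := exists b : chain R X 2, bdry b = c - c'.

Lemma homologousxx c : homologous c c.
Proof. by exists 0; rewrite raddf0 subrr. Qed.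

Lemma homologousD c1 c1' c2 c2' :
  homologous c1 c1' -> homologous c2 c2' -> homologous (c1 + c2) (c1' + c2').
Proof.
by move=> [b1 E1] [b2 E2]; exists (b1 + b2); rewrite raddfD /= E1 E2 opprD addrACA.
Qed.

Lemma homologousMz c c' n : homologous c c' -> homologous (c *~ n) (c' *~ n).
Proof. by move=> [b E]; exists (b *~ n); rewrite raddfMz /= E mulrzBl. Qed.

Lemma homologousN c c' : homologous c c' -> homologous (- c) (- c').
Proof. by move=> [b E]; exists (- b); rewrite raddfN /= E opprB opprK addrC. Qed.

Lemma homologous_sym c c' : homologous c c' -> homologous c' c.
Proof. by move=> [b E]; exists (- b); rewrite raddfN /= E opprB. Qed.

Lemma homologous_trans c1 c2 c3 :
  homologous c1 c2 -> homologous c2 c3 -> homologous c1 c3.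
Proof.
by move=> [b1 E1] [b2 E2]; exists (b1 + b2); rewrite raddfD /= E1 E2 addrA subrK.
Qed.

Lemma homologousB c1 c1' c2 c2' :
  homologous c1 c1' -> homologous c2 c2' -> homologous (c1 - c2) (c1' - c2').
Proof. by move=> h1 /homologousN h2; exact: homologousD. Qed.

Lemma homologous_simplices (v : chain R X 1 -> chain R X 1) : zmod_morphism v ->
  (forall s, homologous << s >> (v << s >>)) -> forall c, homologous c (v c).
Proof.
move=> vB vs c.
pose va := GRing.isZmodMorphism.Build _ _ v vB.
pose v' : {additive chain R X 1 -> chain R X 1} := HB.pack v va.
change (homologous c (v' c)).
rewrite -[c]freeg_sumE !raddf_sum.
elim: (dom _) => [|s r IH]; first by rewrite !big_nil; exact: homologousxx.
rewrite !big_cons; apply: homologousD => //.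
rewrite -[coeff s c]intz -freegU_mulz.
rewrite (raddfMz v'); apply: homologousMz; exact: vs.
Qed.

End Homologous.

(** * First homology of the annulus and the circle *)

Section AnnulusHomology.
Context (R : realType).
Implicit Types (v w : R * R) (a : continuousType R (R * R)%type).
Notation A := (annulus R).

Definition projc : continuousType (R * R)%type A := mkcts (@continuous_proj R).

Definition path_chain a : chain R A 1 := << sx1 (projc \o a) >>.

Lemma continuous_seg v : continuous (fun u : R => (u * v.1, u * v.2)).
Proof.
move=> u.
have c (r : R) : {for u, continuous (fun u : R => u * r)}.
  by apply: contM; [exact: cvg_id|exact: contC].
exact: (cont_pair (c v.1) (c v.2)).
Qed.

Definition seg v : continuousType R (R * R)%type := mkcts (continuous_seg (v := v)).

Definition tau : R * R := (0, 1).
Definition core : chain R A 1 := path_chain (seg tau).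

Lemma eq_path_chain a a' : (forall u, 0 <= u <= 1 -> proj (a u) = proj (a' u)) ->
  path_chain a = path_chain a'.
Proof. by move=> aa'; congr << _ >>; exact: eq_sx1. Qed.

Lemma bdry_triangle (g : R * R -> R * R) (a0 a1 a2 : continuousType R (R * R)%type) :
  continuous g -> (forall u, a0 u = g (1 - u, u)) -> (forall u, a1 u = g (0, u)) ->
  (forall u, a2 u = g (u, 0)) ->
  exists b, bdry b = path_chain a0 - path_chain a1 + path_chain a2.
Proof.
move=> gc E0 E1 E2; exists << sx2 (projc \o mkcts gc) >>.
by apply: bdry_sx2 => u /=; rewrite ?E0 ?E1 ?E2.
Qed.

Lemma seg_0 : homologous (path_chain (seg 0)) 0.
Proof.
have c0 : continuous (fun _ : R * R => (0 : R, 0 : R)) by move=> x; exact: cvg_cst.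
have [|u|u|b E] := bdry_triangle (a0 := seg 0) (a1 := seg 0) (a2 := seg 0) c0.
- by move=> u /=; rewrite /mkcts /= !mulr0.
- by rewrite /= /mkcts /= !mulr0.
- by rewrite /= /mkcts /= !mulr0.
by exists b; rewrite E subrr add0r subr0.
Qed.

(** The cone [(s, t) |-> s * a t] over the path is a square, cut along its diagonal [u |-> u * a u]
    into two triangles; its collapsed side is null-homologous by [seg_0]. *)
Lemma path_chain_ends a :
  homologous (path_chain a) (path_chain (seg (a 1)) - path_chain (seg (a 0))).
Proof.
have ac := @cts_fun _ _ a.
have sc (s t : R * R -> R) : (forall v, {for v, continuous s}) ->
    (forall v, {for v, continuous t}) ->
    continuous (fun v => (s v * (a (t v)).1, s v * (a (t v)).2)).
  move=> hs ht v.
  have cat : {for v, continuous (fun v => a (t v))}.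
    by apply: (@continuous_comp _ _ _ t a); [exact: ht|exact: ac].
  have cat1 := cont_fst cat; have cat2 := cont_snd cat.
  exact: (cont_pair (contM (hs v) cat1) (contM (hs v) cat2)).
have c1 (v : R * R) : {for v, continuous (fun v : R * R => v.2)} by exact: cvg_snd.
have c2 (v : R * R) : {for v, continuous (fun v : R * R => v.1 + v.2)}.
  by apply: contD; [exact: cvg_fst|exact: cvg_snd].
have dc : continuous (fun u : R => (u * (a u).1, u * (a u).2)).
  move=> u.
  have a1 := cont_fst (ac u); have a2 := cont_snd (ac u).
  have i : {for u, continuous (fun u : R => u)} by exact: cvg_id.
  exact: (cont_pair (contM i a1) (contM i a2)).
have [||u|b1 E1] := bdry_triangle (a0 := a) (a1 := mkcts dc) (a2 := seg (a 0)) (sc _ _ c2 c1).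
- by move=> u /=; rewrite subrK !mul1r; case: (a u).
- by move=> u /=; rewrite add0r.
- by rewrite /= addr0.
have [||u|b2 E2] := bdry_triangle (a0 := seg (a 1)) (a1 := mkcts dc) (a2 := seg 0) (sc _ _ c1 c2).
- by move=> u /=; rewrite subrK.
- by move=> u /=; rewrite add0r.
- by rewrite /= /mkcts /= !mulr0 !mul0r.
have [b3 E3] := seg_0.
exists (b1 - b2 + b3); rewrite raddfD raddfB /= E1 E2 E3 subr0.
have zE (V : zmodType) (p D s0 s1 z : V) : p - D + s0 - (s1 - D + z) + z = p - (s1 - s0).
  rewrite opprB !opprD !opprK !addrA subrK -!addrA; congr (p + _).
  by rewrite addrC -!addrA subrr addr0.
exact: zE.
Qed.

(** The triangle with vertices [0], [tau] and [v + tau]: its side from [tau] to [v + tau] projects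
    to the same path as [seg v]. *)
Lemma path_chain_shift1 v :
  homologous (path_chain (seg (shift 1 v))) (path_chain (seg v) + core).
Proof.
have gc : continuous (fun w : R * R => (w.2 * v.1, w.1 + w.2 * (v.2 + 1))).
  move=> w.
  have c1 : {for w, continuous (fun w : R * R => w.1)} by exact: cvg_fst.
  have c2 : {for w, continuous (fun w : R * R => w.2)} by exact: cvg_snd.
  have k (r : R) : {for w, continuous (fun _ : R * R => r)} by exact: contC.
  exact: (cont_pair (contM c2 (k v.1)) (contD c1 (contM c2 (k (v.2 + 1))))).
have sc : continuous (fun u : R => (u * v.1, u * v.2 + 1)).
  move=> u.
  have c1 : {for u, continuous (fun u : R => u)} by exact: cvg_id.
  have k (r : R) : {for u, continuous (fun _ : R => r)} by exact: contC.
  exact: (cont_pair (contM c1 (k v.1)) (contD (contM c1 (k v.2)) (k 1))).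
have [|u|u|b E] :=
  bdry_triangle (a0 := mkcts sc) (a1 := seg (shift 1 v)) (a2 := seg tau) gc.
- by move=> u /=; rewrite /mkcts /=; congr pair; ring.
- by rewrite /= /mkcts /= add0r.
- by rewrite /= /mkcts /= !mul0r addr0 mulr0 mulr1.
exists (- b); rewrite raddfN /= E /core.
have -> : path_chain (mkcts sc) = path_chain (seg v).
  apply: eq_path_chain => u _; rewrite /= /mkcts.
  exact: (proj_shift 1 (u * v.1, u * v.2)).
by rewrite !opprD !opprK [- _ + _]addrC addrA.
Qed.

Lemma path_chain_shift n v :
  homologous (path_chain (seg (shift n v))) (path_chain (seg v) + core *~ n).
Proof.
elim/int_ind: n => [|n IH|n IH].
- by rewrite shift0 mulr0z addr0; exact: homologousxx.
- have -> : (n.+1 : int) = n%:Z + 1 by lia.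
  rewrite -shiftD; apply: homologous_trans (path_chain_shift1 _) _.
  rewrite mulrzDr mulr1z addrA.
  by apply: homologousD; [|exact: homologousxx].
- have E : shift (- n%:Z) v = shift 1 (shift (- n.+1%:Z) v).
    by rewrite shiftD; congr (shift _ v); lia.
  rewrite E in IH.
  have := homologous_trans (homologous_sym (path_chain_shift1 _)) IH.
  move=> /homologousB/(_ (homologousxx core)); rewrite addrK -addrA.
  have -> : - (n.+1 : int) = - n%:Z - 1 by lia.
  by rewrite mulrzBr mulr1z.
Qed.

Definition turns v : int := Num.floor v.2.

Lemma turns_shift n v : turns (shift n v) = turns v + n.
Proof. by rewrite /turns /shift /= floorDrz ?intr_int // intrKfloor. Qed.

(** The representative of the fibre in the fundamental domain [0 <= v.2 < 1]; it jumps across the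
    boundary of that domain. *)
Definition base (p : A) : R * R :=
  let v := proj1_sig (cid (proj_surj p)) in shift (- turns v) v.

Lemma baseE v : v = shift (turns v) (base (proj v)).
Proof.
rewrite /base; set w := proj1_sig _.
have /proj_inj[n nE] : proj w = proj v := proj2_sig (cid (proj_surj (proj v))).
by rewrite shiftD nE turns_shift; congr (shift _ w); ring.
Qed.

Lemma base_chain v :
  homologous (path_chain (seg v)) (path_chain (seg (base (proj v))) + core *~ turns v).
Proof. by rewrite {1}[v]baseE; exact: path_chain_shift. Qed.

Lemma path_lift (g : continuousType R A) : exists a : continuousType R (R * R)%type,
  forall u, proj (a u) = g u.
Proof.
have gc : continuous (fun v : R * R => g v.1).
  by move=> v; apply: (@continuous_comp _ _ _ fst g); [exact: cvg_fst|exact: cts_fun].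
have [e e0] := proj_surj (g 0).
have [L [Lc Lg _]] := lift_proj gc e0.
have ac : continuous (fun u : R => L (u, 0)).
  move=> u; apply: (@continuous_comp _ _ _ (fun u : R => (u, 0 : R)) L); last exact: Lc.
  by apply: cont_pair; [exact: cvg_id|exact: cvg_cst].
by exists (mkcts ac) => u; rewrite /= /mkcts Lg.
Qed.

Lemma simplex_lift (s : singular_simplex R A 1) :
  exists a : continuousType R (R * R)%type, s = sx1 (projc \o a).
Proof.
have [g ->] := sx1_surj s; have [a ag] := path_lift g.
by exists a; apply: eq_sx1 => u _; rewrite /= -ag.
Qed.

(** An integral cocycle, defined on closed and open paths alike. The choice of lift disappears in
    [winding_path], since two lifts differ by one deck transformation. *)
Definition winding1 (s : singular_simplex R A 1) : int^o :=
  let a := proj1_sig (cid (simplex_lift s)) in turns (a 1) - turns (a 0).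

Definition winding (c : chain R A 1) : int := fglift winding1 c.

Lemma winding_is_zmod_morphism : zmod_morphism winding.
Proof. by move=> c c'; exact: (lift_is_additive winding1 c c'). Qed.
HB.instance Definition _ :=
  GRing.isZmodMorphism.Build (chain R A 1) int winding winding_is_zmod_morphism.

Lemma windingU s : winding << s >> = winding1 s.
Proof. by rewrite /winding liftU scale1r. Qed.

Lemma winding_path a : winding (path_chain a) = turns (a 1) - turns (a 0).
Proof.
rewrite windingU /winding1; set a' := proj1_sig _.
have E : sx1 (projc \o a) = sx1 (projc \o a') :=
  proj2_sig (cid (simplex_lift (sx1 (projc \o a)))).
have cc (b : continuousType R (R * R)%type) : continuous (fun u => b (clamp u)).
  move=> u; apply: (@continuous_comp _ _ _ (@clamp R) b).
    exact: continuous_clamp.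
  exact: cts_fun.
have [|u|n nE] := lift_proj_unique _ (cc a) (cc a').
- by apply/connected_intervalP => x y _ _ z _.
- exact: (sx1_inj E (clamp_itv u)).
have := nE 0; have := nE 1; rewrite !clamp_id ?lexx ?ler01 // => -> ->.
by rewrite !turns_shift; ring.
Qed.

(** A triangle lifts to the plane as a whole, and the differences of [turns] along its sides
    telescope. *)
Lemma winding_bdry (b : chain R A 2) : winding (bdry b) = 0.
Proof.
rewrite -[b]freeg_sumE !raddf_sum /= big1 // => s _.
rewrite -[coeff s b]intz -freegU_mulz !raddfMz /=.
have [g ->] := sx2_surj s.
have [e e0] := proj_surj (g (0, 0)).
have [L [Lc Lg _]] := lift_proj (@cts_fun _ _ g) e0.
have side (x y : R -> R) : (forall u, {for u, continuous x}) ->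
    (forall u, {for u, continuous y}) -> continuous (fun u => L (x u, y u)).
  move=> xc yc u; apply: (@continuous_comp _ _ _ (fun u => (x u, y u)) L).
    exact: cont_pair.
  exact: Lc.
have ci (u : R) : {for u, continuous (fun u : R => u)} by exact: cvg_id.
have cr (u : R) : {for u, continuous (fun u : R => 1 - u)}.
  by apply: contB; [exact: contC|exact: cvg_id].
have c0 (u : R) : {for u, continuous (fun _ : R => 0 : R)} by exact: contC.
rewrite (bdry_sx2 (e0 := projc \o mkcts (side _ _ cr ci))
  (e1 := projc \o mkcts (side _ _ c0 ci)) (e2 := projc \o mkcts (side _ _ ci c0))) //;
  do ?by move=> u /=; rewrite /mkcts Lg.
rewrite raddfD raddfB /= !winding_path /= /mkcts subrr subr0.
by rewrite [X in X *~ _](_ : _ = 0) ?mul0rz //; ring.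
Qed.

(** A standard path to each vertex: the correction for chains that are not cycles. *)
Definition start_chain (x : singular_simplex R A 0) : chain R A 1 :=
  path_chain (seg (base (x (point0 R)))).

Definition start (c : chain R A 0) : chain R A 1 := fglift start_chain c.

Lemma start_is_zmod_morphism : zmod_morphism start.
Proof. by move=> c c'; exact: (lift_is_additive start_chain c c'). Qed.
HB.instance Definition _ :=
  GRing.isZmodMorphism.Build (chain R A 0) (chain R A 1) start start_is_zmod_morphism.

(** Coning replaces a simplex by the segments to the two ends of its lift, and each of these is a
    segment to a base point plus turns of the core. On cycles the segments to base points cancel. *)
Lemma homologous_core c : homologous c (core *~ winding c + start (bdry c)).
Proof.
apply: (homologous_simplices (v := fun c => core *~ winding c + start (bdry c))).
  by move=> x y; rewrite !raddfB /= ?mulrzBr opprD addrACA.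
move=> s; have [a ->] := simplex_lift s.
rewrite bdry_sx1 raddfB /= /start !liftU !scale1r /start_chain /=.
rewrite -/(path_chain a) winding_path.
apply: homologous_trans (path_chain_ends a) _.
have h := homologousB (base_chain (a 1)) (base_chain (a 0)).
apply: homologous_trans h _.
rewrite opprD addrACA -mulrzBr addrC /cst /= /mkcts.
exact: homologousxx.
Qed.

Definition path_loop a (n : int) (an : a 1 = shift n (a 0)) : cycle1 R A.
Proof.
apply: (@Cycle1 _ _ (path_chain a)).
rewrite unfold_in /is_cycle bdry_sx1 /= /mkcts an proj_shift subrr.
exact: eqxx.
Defined.

Lemma seg_tau_loop : seg tau 1 = shift 1 (seg tau 0).
Proof. by rewrite /= /mkcts /shift /= !mul0r !mul1r add0r. Qed.

Definition core_loop : cycle1 R A := path_loop seg_tau_loop.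
Definition core_class : H1 R A := homology_class core_loop.

Lemma winding_core : winding core = 1.
Proof.
rewrite /core winding_path /= /mkcts /turns /= !mul1r !mul0r.
by rewrite floor1 floor0 subr0.
Qed.

Lemma cycle1Mz (z : cycle1 R A) n : cycle_chain (z *~ n) = cycle_chain z *~ n.
Proof. exact: (raddfMz (val : {additive cycle1 R A -> chain R A 1})). Qed.

Lemma homology_winding (z : cycle1 R A) :
  homology_class z = core_class *~ winding (cycle_chain z).
Proof.
rewrite /core_class -raddfMz; apply/homology_classP.
have [b E] := homologous_core z; exists b.
rewrite E; congr (_ - _); rewrite (eqP (cycle_chainP z)) raddf0 addr0.
by rewrite raddfMz.
Qed.

Lemma homology_windingP (z w : cycle1 R A) :
  homology_class z = homology_class w <-> winding (cycle_chain z) = winding (cycle_chain w).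
Proof.
split=> [/homology_classP[b]|]; last by rewrite !homology_winding => ->.
move=> /(congr1 winding); rewrite winding_bdry raddfB => /esym/eqP.
by rewrite subr_eq0 => /eqP.
Qed.

Lemma core_classMz_inj (m n : int) : core_class *~ m = core_class *~ n -> m = n.
Proof.
rewrite /core_class -!raddfMz => /homology_windingP.
by rewrite !cycle1Mz !raddfMz /= -/core winding_core !intz.
Qed.

Lemma core_class_gen (x : H1 R A) : exists n : int, x = core_class *~ n.
Proof.
have [z ->] := homology_class_surj x.
by exists (winding (cycle_chain z)); exact: homology_winding.
Qed.

(** The image of the core lifts to [F \o seg tau], whose ends differ by [n] turns. *)
Lemma H1map_core (f : continuousType A A) (F : continuousType (R * R)%type (R * R)%type) n :
  (forall v, proj (F v) = f (proj v)) -> F (0, 1) = shift n (F (0, 0)) ->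
  H1map f core_class = core_class *~ n.
Proof.
move=> Ff Fn; rewrite /core_class H1mapE homology_winding; congr (_ *~ _).
have -> : cycle_chain (push_cycle1 f core_loop) = path_chain (F \o seg tau).
  rewrite /= /core /path_chain pushU; congr << _ >>.
  by apply/continuousEP => t /=; rewrite /mkcts -Ff.
rewrite winding_path /= /mkcts !mul1r !mul0r Fn turns_shift; ring.
Qed.

Lemma has_degree_lift (f : continuousType A A)
    (F : continuousType (R * R)%type (R * R)%type) (d n : int) :
  has_degree f d -> (forall v, proj (F v) = f (proj v)) ->
  F (0, 1) = shift n (F (0, 0)) -> n = d.
Proof.
move=> fd Ff Fn; apply: core_classMz_inj.
by rewrite -fd (H1map_core Ff Fn).
Qed.

(** Projected, the path closes up to a loop inside [U] whose class maps to the generator. *)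
Lemma essential_path (U : set A) a :
  (forall t, U (proj (a t))) -> a 1 = shift 1 (a 0) -> essential_open U.
Proof.
move=> aU a1 x; have [n ->] := core_class_gen x.
have gc : continuous (fun t => SigSub (mem_set (aU t)) : U).
  apply: (@continuous_comp_initial _ _ _ set_val) => t.
  apply: (@continuous_comp _ _ _ a (@proj R)); first exact: cts_fun.
  exact: continuous_proj.
have zP : << sx1 (mkcts gc) >> \in @is_cycle R U.
  rewrite unfold_in /is_cycle bdry_sx1 subr_eq0; apply/eqP; congr << sx0 _ _ >>.
  by apply: val_inj; rewrite /= /mkcts /= a1 proj_shift.
exists (homology_class (Cycle1 zP) *~ n).
rewrite raddfMz /= H1mapE homology_winding; congr (_ *~ _).
have -> : cycle_chain (push_cycle1 (inclusion U) (Cycle1 zP)) = path_chain a.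
  rewrite /= pushU; congr << _ >>.
  by apply/continuousEP => t.
by rewrite winding_path a1 turns_shift addrAC subrr add0r.
Qed.

End AnnulusHomology.

Section Functoriality.
Context (R : realType) (X Y Z : topologicalType).

Lemma H1map_comp (f : continuousType X Y) (g : continuousType Y Z) (x : H1 R X) :
  H1map g (H1map f x) = H1map (g \o f) x.
Proof.
have [z ->] := homology_class_surj x; rewrite !H1mapE; congr homology_class.
apply: val_inj => /=; set c := cycle_chain z.
rewrite -[c]freeg_sumE !raddf_sum /=; apply: eq_bigr => s _.
rewrite -[coeff s c]intz -freegU_mulz !raddfMz /= !pushU.
by congr (<< _ >> *~ _); apply/continuousEP.
Qed.

Lemma H1map_id (f : continuousType X X) (x : H1 R X) : f =1 id -> H1map f x = x.
Proof.
move=> fid; have [z ->] := homology_class_surj x; rewrite !H1mapE; congr homology_class.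
apply: val_inj => /=; set c := cycle_chain z.
rewrite -[c]freeg_sumE !raddf_sum /=.
apply: eq_bigr => s _.
rewrite -[coeff s c]intz -freegU_mulz !raddfMz /= !pushU.
by congr (<< _ >> *~ _); apply/continuousEP => t /=; rewrite fid.
Qed.

End Functoriality.

(** The inverse is induced by the inclusion [i] of a circle of fixed radius: [i \o h] lifts to
    [(0, H v)] and so fixes the core class, while the retraction [p] makes [i] injective on
    homology. *)
Lemma H1map_circle_bij (R : realType) (h : continuousType (annulus R) (circle R))
    (H : R * R -> R) : continuous H ->
  (forall v, expi (H v) = h (proj v)) -> H (0, 1) = H (0, 0) + 1 ->
  bijective (@H1map R _ _ h).
Proof.
move=> Hc Hh Hs.
pose i0 (z : circle R) : annulus R := ((proj (0, 0)).1, z).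
have ic : continuous i0.
  move=> z; apply: (@cont_pair _ (open_interval R) (circle R) (fun=> (proj (0, 0)).1) (fun w => w)).
    exact: cst_continuous.
  exact: cvg_id.
have pc : continuous (snd : annulus R -> circle R) by move=> a; exact: cvg_snd.
pose i := mkcts ic; pose p := mkcts pc.
have piK (x : H1 R (circle R)) : H1map p (H1map i x) = x by rewrite H1map_comp H1map_id.
have Fc : continuous (fun v : R * R => (0 : R, H v)).
  by move=> v; apply: cont_pair; [exact: cvg_cst|exact: Hc].
have ih (x : H1 R (annulus R)) : H1map i (H1map h x) = x.
  have [n ->] := core_class_gen x; rewrite !raddfMz /=; congr (_ *~ _).
  rewrite H1map_comp (@H1map_core _ _ (mkcts Fc) 1) ?mulr1z //.
    by move=> v; rewrite /= /mkcts /i0 -Hh; congr pair; apply: val_inj.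
  by rewrite /= /mkcts Hs.
exists (H1map i) => // x.
by rewrite -[LHS]piK ih piK.
Qed.

(** * Paths in the plane *)

Section Linked.
Context (R : realType).
Implicit Types (S T : set (R * R)) (p q r : R * R).

(** Paths live on the whole line and stay in [S] at all times, so that they are plainly continuous
    and compose without restriction. *)
Definition linked S p q := exists a : R -> R * R,
  [/\ continuous a, forall t, S (a t), a 0 = p & a 1 = q].

Lemma linked_in S p q : linked S p q -> S p /\ S q.
Proof. by case=> a [_ Sa <- <-]. Qed.

Lemma linked_refl S p : S p -> linked S p p.
Proof. by move=> Sp; exists (fun=> p); split => // t; exact: cvg_cst. Qed.

Lemma linked_sym S p q : linked S p q -> linked S q p.
Proof.
move=> [a [ac aS a0 a1]]; exists (fun t => a (1 - t)); split => //.
- have c (t : R) : {for t, continuous (fun t : R => 1 - t)}.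
    by apply: contB; [exact: contC|exact: cvg_id].
  by move=> t; apply: (@continuous_comp _ _ _ (fun t : R => 1 - t) a); [exact: c|exact: ac].
- by rewrite subr0.
- by rewrite subrr.
Qed.

Lemma linked_trans S p q r : linked S p q -> linked S q r -> linked S p r.
Proof.
move=> [a [ac aS a0 a1]] [b [bc bS b0 b1]].
pose x t := a (clamp (2 * t)); pose y t := b (clamp (2 * t - 1)).
pose c t := ((x t).1 + (y t).1 - q.1, (x t).2 + (y t).2 - q.2).
have xc t : {for t, continuous (fun t : R => a (clamp (2 * t)))}.
  apply: (@continuous_comp _ _ _ (fun t : R => clamp (2 * t)) a); last exact: ac.
  apply: cont_comp; first exact: continuous_clamp.
  by apply: contM; [exact: contC|exact: cvg_id].
have yc t : {for t, continuous (fun t : R => b (clamp (2 * t - 1)))}.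
  apply: (@continuous_comp _ _ _ (fun t : R => clamp (2 * t - 1)) b); last exact: bc.
  apply: cont_comp; first exact: continuous_clamp.
  apply: (@contB R R (fun t => 2 * t) (fun=> 1)); last exact: contC.
  by apply: contM; [exact: contC|exact: cvg_id].
have clamp0 t : t <= 0 -> clamp t = 0 :> R.
  by move=> t0; rewrite /clamp max_l // ge_min t0.
have clamp1 t : 1 <= t -> clamp t = 1 :> R.
  by move=> t0; rewrite /clamp min_r // max_r.
have cx t : t <= 1 / 2 -> c t = x t.
  move=> t2; rewrite /c /y clamp0; last by lra.
  by rewrite b0 !addrK -surjective_pairing.
have cy t : 1 / 2 <= t -> c t = y t.
  move=> t2; rewrite /c /x clamp1; last by lra.
  by rewrite a1 (addrC q.1) (addrC q.2) !addrK -surjective_pairing.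
exists c; split.
- move=> t; have k (c0 : R) : {for t, continuous (fun _ : R => c0)} by exact: contC.
  exact: (cont_pair (contB (contD (cont_fst (xc t)) (cont_fst (yc t))) (k q.1))
    (contB (contD (cont_snd (xc t)) (cont_snd (yc t))) (k q.2))).
- move=> t; have [t2|t2] := leP t (1 / 2); first by rewrite cx //; exact: aS.
  by rewrite cy; [exact: bS|exact: ltW].
- by rewrite cx ?divr_ge0 // /x mulr0 clamp0.
- by rewrite cy ?ler_pdivrMr // ?mul1r ?ler1n // /y clamp1 //; lra.
Qed.

Lemma linked_map S T (g : R * R -> R * R) p q : continuous g ->
  (forall x, S x -> T (g x)) -> linked S p q -> linked T (g p) (g q).
Proof.
move=> gc gST [a [ac aS a0 a1]]; exists (g \o a); split => /=; try congruence.
  by move=> t; apply: continuous_comp; [exact: ac|exact: gc].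
by move=> t; exact: gST.
Qed.

Lemma linked_sub S T p q : S `<=` T -> linked S p q -> linked T p q.
Proof. by move=> ST; apply: (@linked_map _ _ id) => // x; exact: cvg_id. Qed.

Lemma linked_line S p q :
  (forall t, 0 <= t <= 1 ->
    S (p.1 + t * (q.1 - p.1), p.2 + t * (q.2 - p.2))) -> linked S p q.
Proof.
move=> Spq.
exists (fun t => (p.1 + clamp t * (q.1 - p.1), p.2 + clamp t * (q.2 - p.2))); split.
- move=> t.
  have k (c : R) : {for t, continuous (fun _ : R => c)} by exact: contC.
  have c := @continuous_clamp R t.
  exact: (cont_pair (contD (k _) (contM c (k _))) (contD (k _) (contM c (k _)))).
- by move=> t; apply: Spq; exact: clamp_itv.
- by rewrite clamp_id ?lexx ?ler01 // !mul0r !addr0 -surjective_pairing.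
- by rewrite clamp_id ?lexx ?ler01 // !mul1r !subrKC -surjective_pairing.
Qed.

Lemma linked_near S p : open S -> S p -> \forall q \near p, linked S p q.
Proof.
move=> So Sp; have /nbhs_ballP[e e0 eS] : nbhs p S by exact: open_nbhs_nbhs.
have : nbhs p (ball p e) by exact: nbhsx_ballx.
apply: filterS => q [] /=; rewrite /ball /= => pq1 pq2.
apply: linked_line => t /andP[t0 t1]; apply: eS; split; rewrite /= /ball /=.
  rewrite opprD addNKr normrN normrM ger0_norm // distrC.
  by apply: le_lt_trans pq1; rewrite ler_piMl.
rewrite opprD addNKr normrN normrM ger0_norm // distrC.
by apply: le_lt_trans pq2; rewrite ler_piMl.
Qed.

Lemma linked_near_stable S p q : open S -> linked S p q ->
  \forall q' \near q, linked S p q'.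
Proof.
move=> So pq; have [_ Sq] := linked_in pq.
by apply: filterS (linked_near So Sq) => q'; exact: linked_trans.
Qed.

Lemma nlinked_near_stable S p q : open S -> S q -> ~ linked S p q ->
  \forall q' \near q, ~ linked S p q'.
Proof.
move=> So Sq pq; apply: filterS (linked_near So Sq) => q' qq' pq'; apply: pq.
by apply: linked_trans pq' _; exact: linked_sym.
Qed.

Lemma connected_linked S (C : set (R * R)) p q : open S -> connected C -> C `<=` S ->
  C p -> C q -> linked S p q.
Proof.
move=> So Cc CS Cp Cq.
apply: (@connected_clopen _ C [set x | linked S p x] p Cc Cp) => //=.
- by apply: linked_refl; exact: CS.
- by move=> x _ px; exact: (linked_near_stable So px).
- by move=> x Cx npx; exact: (nlinked_near_stable So (CS _ Cx) npx).
Qed.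

Lemma stay_above (u : R -> R) (c : R) : continuous u -> (forall t, u t != c) ->
  c < u 0 -> c < u 1.
Proof.
move=> uc uN u0; rewrite ltNge; apply/negP => u1.
have [] := @IVT R u 0 1 c ler01.
- by apply: continuous_subspaceT.
- by rewrite ge_min u1 orbT le_max ltW.
- by move=> t _ /eqP; apply/negP; exact: uN.
Qed.

Lemma stay_above_rev (u : R -> R) (c : R) : continuous u -> (forall t, u t != c) ->
  c < u 1 -> c < u 0.
Proof.
move=> uc uN u0; rewrite ltNge; apply/negP => u1.
have [] := @IVT R u 0 1 c ler01.
- by apply: continuous_subspaceT.
- by rewrite ge_min u1 /= le_max (ltW u0) orbT.
- by move=> t _ /eqP; apply/negP; exact: uN.
Qed.

(** * Crossing of two paths that join opposite sides of a rectangle *)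

Lemma angle_quarter : angle (1 / 4) = pi / 2 :> R.
Proof. by rewrite /angle -mulr_natr; field. Qed.

Lemma angle_half : angle (1 / 2) = pi :> R.
Proof. by rewrite /angle -mulr_natr; field. Qed.

Lemma angleN (x : R) : angle (- x) = - angle x.
Proof. by rewrite /angle mulNr. Qed.

Lemma angle_le (x y : R) : (angle x <= angle y) = (x <= y).
Proof. by rewrite ler_pM2r // mulr2n addr_gt0 // pi_gt0. Qed.

Lemma sin_angle_ge0 (x : R) : 0 <= x <= 1 / 2 -> 0 <= sin (angle x).
Proof.
move=> /andP[x0 x1]; apply: sin_ge0_pi; rewrite -angle_half angle_le x1 andbT.
by rewrite /angle mulr_ge0 // mulrn_wge0 // pi_ge0.
Qed.

Lemma cos_angle_ge0 (x : R) : - (1 / 4) <= x <= 1 / 4 -> 0 <= cos (angle x).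
Proof.
by move=> ?; apply: cos_ge0_pihalf; rewrite -angle_quarter -angleN !angle_le.
Qed.

(* A point [(cos, sin)] turning once around the circle through its four
   quadrants cannot have a continuous angle. *)
Lemma no_full_turn (th : R * R -> R) : continuous th ->
  (forall t, 0 < cos (angle (th (0, t)))) -> (forall t, cos (angle (th (1, t))) < 0) ->
  (forall s, sin (angle (th (s, 0))) < 0) -> (forall s, 0 < sin (angle (th (s, 1)))) ->
  th (0, 0) < 0 -> - (1 / 4) < th (0, 0) -> False.
Proof.
move=> thc c0 c1 s0 s1 t00 t00'.
have vc s : continuous (fun t : R => th (s, t)).
  move=> t; apply: (@continuous_comp _ _ _ (fun t : R => (s, t)) th); last exact: thc.
  by apply: cont_pair; [exact: cvg_cst|exact: cvg_id].
have hc t : continuous (fun s : R => th (s, t)).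
  move=> s; apply: (@continuous_comp _ _ _ (fun s : R => (s, t)) th); last exact: thc.
  by apply: cont_pair; [exact: cvg_id|exact: cvg_cst].
have cosq : cos (angle (1 / 4)) = 0 :> R by rewrite angle_quarter cos_pihalf.
(* The square is traversed from [(0, 0)] through [(0, 1)], [(1, 1)] and [(1, 0)]: each side excludes
   one multiple of a quarter turn, and the sign at each corner improves the lower bound. Back at the
   start the angle exceeds half a turn. *)
have t01 : - (1 / 4) < th (0, 1).
  apply: (stay_above (vc 0)) t00' => t; apply/eqP => E; have := c0 t.
  by rewrite E angleN cosN cosq ltxx.
have {}t01 : 0 < th (0, 1).
  rewrite ltNge; apply/negP => t1; have := s1 0; rewrite ltNge => /negP; apply.
  rewrite -oppr_ge0 -sinN -angleN; apply: sin_angle_ge0; lra.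
have t11 : 0 < th (1, 1).
  apply: (stay_above (hc 1)) t01 => s; apply/eqP => E; have := s1 s.
  by rewrite E /angle mul0r sin0 ltxx.
have {}t11 : 1 / 4 < th (1, 1).
  rewrite ltNge; apply/negP => t1; have := c1 1; rewrite ltNge => /negP; apply.
  apply: cos_angle_ge0; lra.
have t10 : 1 / 4 < th (1, 0).
  apply: (stay_above_rev (vc 1)) t11 => t; apply/eqP => E; have := c1 t.
  by rewrite E cosq ltxx.
have {}t10 : 1 / 2 < th (1, 0).
  rewrite ltNge; apply/negP => t1; have := s0 1; rewrite ltNge => /negP; apply.
  apply: sin_angle_ge0; lra.
have : 1 / 2 < th (0, 0).
  apply: (stay_above_rev (hc 0)) t10 => s; apply/eqP => E; have := s0 s.
  by rewrite E angle_half sinpi ltxx.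
lra.
Qed.

(** On each side of the parameter square one coordinate of [g t - e s] keeps a fixed sign, so if the
    difference never vanished its direction would make the full turn excluded by [no_full_turn]. *)
Lemma crossing (g e : R -> R * R) : continuous g -> continuous e ->
  (forall t, 0 <= t <= 1 -> (e 0).1 < (g t).1 < (e 1).1) ->
  (forall s, 0 <= s <= 1 -> (g 0).2 < (e s).2 < (g 1).2) ->
  exists s t, g t = e s.
Proof.
move=> gc ec ge1 ge2; apply: contrapT => nge.
pose D1 (v : R * R) := (g (clamp v.2)).1 - (e (clamp v.1)).1.
pose D2 (v : R * R) := (g (clamp v.2)).2 - (e (clamp v.1)).2.
have g2c (v : R * R) : {for v, continuous (fun v : R * R => g (clamp v.2))}.
  apply: (@continuous_comp _ _ _ (fun v : R * R => clamp v.2) g); last exact: gc.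
  by apply: cont_comp; [exact: continuous_clamp|exact: cvg_snd].
have e1c (v : R * R) : {for v, continuous (fun v : R * R => e (clamp v.1))}.
  apply: (@continuous_comp _ _ _ (fun v : R * R => clamp v.1) e); last exact: ec.
  by apply: cont_comp; [exact: continuous_clamp|exact: cvg_fst].
have D1c v : {for v, continuous D1} := contB (cont_fst (g2c v)) (cont_fst (e1c v)).
have D2c v : {for v, continuous D2} := contB (cont_snd (g2c v)) (cont_snd (e1c v)).
pose N v := Num.sqrt (D1 v ^+ 2 + D2 v ^+ 2).
have N2 v : 0 < D1 v ^+ 2 + D2 v ^+ 2.
  rewrite lt_neqAle addr_ge0 ?sqr_ge0 // andbT eq_sym paddr_eq0 ?sqr_ge0 //.
  apply/negP; rewrite !sqrf_eq0 !subr_eq0 => /andP[/eqP E1 /eqP E2]; apply: nge.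
  exists (clamp v.1), (clamp v.2).
  by rewrite [LHS]surjective_pairing E1 E2 -surjective_pairing.
have N0 v : 0 < N v by rewrite sqrtr_gt0.
have Nc v : {for v, continuous N}.
  apply: (@cont_comp _ _ _ (@Num.sqrt R) (fun v => D1 v ^+ 2 + D2 v ^+ 2)).
    exact: sqrt_continuous.
  exact: (contD (contM (D1c v) (D1c v)) (contM (D2c v) (D2c v))).
have NVc v : {for v, continuous (fun v => (N v)^-1)}.
  by apply: contV => //; rewrite gt_eqF.
have dP v : unit_circle R ((D1 v / N v) +i* (D2 v / N v))%C.
  rewrite /unit_circle /= normc_def /= !expr_div_n sqr_sqrtr ?ltW //.
  by rewrite -mulrDl mulfV ?gt_eqF // sqrtr1.
pose d v : circle R := SigSub (mem_set (dP v)).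
have dc : continuous d.
  apply: (@continuous_comp_initial _ _ _ set_val) => v.
  exact: (continuous_complex (contM (D1c v) (NVc v)) (contM (D2c v) (NVc v))).
pose A v : annulus R := ((proj (0, 0)).1, d v).
have Ac : continuous A.
  move=> v; apply: (@cont_pair _ (open_interval R) (circle R) (fun=> (proj (0, 0)).1) d).
    exact: cst_continuous.
  exact: dc.
have [e0 e0E] := proj_surj (A (0, 0)).
have [L [Lc LA _]] := lift_proj Ac e0E.
pose n := Num.floor (L (0, 0)).2.
(* Normalised so that [th (0, 0)] lies in [[-1, 0[]; the signs of cosine and sine at this corner
   then force it above minus a quarter. *)
pose th v := (L v).2 + (- (n + 1))%:~R.
have thc : continuous th.
  move=> v; have k (r : R) : {for v, continuous (fun _ : R * R => r)} by exact: contC.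
  exact: (contD (cont_snd (Lc v)) (k _)).
have thE v : expi (th v) = d v by rewrite expiDz; exact: (congr1 snd (LA v)).
have cE v : cos (angle (th v)) = D1 v / N v by rewrite -cre_expi thE.
have sE v : sin (angle (th v)) = D2 v / N v by rewrite -cim_expi thE.
have clamp0 : clamp 0 = 0 :> R by rewrite clamp_id // lexx ler01.
have clamp1 : clamp 1 = 1 :> R by rewrite clamp_id // lexx ler01.
have c0 t : 0 < cos (angle (th (0, t))).
  rewrite cE divr_gt0 // /D1 /= clamp0 subr_gt0.
  by have /andP[] := ge1 _ (clamp_itv t).
have c1 t : cos (angle (th (1, t))) < 0.
  rewrite cE pmulr_llt0 ?invr_gt0 // /D1 /= clamp1 subr_lt0.
  by have /andP[] := ge1 _ (clamp_itv t).
have s0 s : sin (angle (th (s, 0))) < 0.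
  rewrite sE pmulr_llt0 ?invr_gt0 // /D2 /= clamp0 subr_lt0.
  by have /andP[] := ge2 _ (clamp_itv s).
have s1 s : 0 < sin (angle (th (s, 1))).
  rewrite sE divr_gt0 // /D2 /= clamp1 subr_gt0.
  by have /andP[] := ge2 _ (clamp_itv s).
have /andP[n0 n1] := Num.Theory.floor_itv (L (0, 0)).2; rewrite -/n in n0 n1.
have tE : th (0, 0) = (L (0, 0)).2 - n%:~R - 1.
  by rewrite /th mulrNz intrD opprD addrA.
rewrite intrD in n1.
have t1 : -1 <= th (0, 0) by rewrite tE; lra.
have t0 : th (0, 0) < 0 by rewrite tE; lra.
apply: (no_full_turn thc c0 c1 s0 s1 t0).
rewrite ltNge; apply/negP => tq.
have th2 : th (0, 0) <= - (1 / 2) \/ - (1 / 2) <= th (0, 0).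
  by case: (lerP (th (0, 0)) (- (1 / 2))) => [|/ltW]; [left|right].
case: th2 => th2.
  have := s0 0; rewrite -cim_expi -(expiDz _ 1) cim_expi ltNge => /negP; apply.
  apply: sin_angle_ge0; lra.
(* between a half and three quarters of a turn the cosine is nonpositive *)
have := c0 0; rewrite ltNge => /negP; apply.
have -> : angle (th (0, 0)) = angle (th (0, 0) + 1 / 2) - pi.
  have aD (x y : R) : angle (x + y) = angle x + angle y by rewrite /angle mulrDl.
  by rewrite aD angle_half addrK.
rewrite cosB cospi sinpi mulr0 addr0 mulrN1 oppr_le0.
apply: cos_angle_ge0; lra.
Qed.

End Linked.

(** * Lifting a trivial connector *)

Section ConnectorLift.
Context (R : realType).
Implicit Types (v w : R * R) (a : annulus R) (n : int).

Lemma path_bounded (b : R -> R * R) : continuous b ->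
  exists M, forall t, 0 <= t <= 1 -> `|(b t).1| < M /\ `|(b t).2| < M.
Proof.
move=> bc; pose f t := `|(b t).1| + `|(b t).2|.
have fc : continuous f.
  by move=> t; exact: (contD (cont_norm (cont_fst (bc t))) (cont_norm (cont_snd (bc t)))).
have [c _ cm] := EVT_max ler01 (continuous_subspaceT fc).
exists (f c + 1) => t t01; have := cm t; rewrite in_itv /= t01 => /(_ isT).
rewrite /f => tc; have := normr_ge0 (b t).1; have := normr_ge0 (b t).2; split; lra.
Qed.

Lemma linked_on (S : set (R * R)) (b : R -> R * R) (s t : R) :
  continuous b -> (forall t, S (b t)) -> linked S (b s) (b t).
Proof.
move=> bc bS; exists (fun u => b (s + u * (t - s))); split => //.
- move=> u; apply: (@continuous_comp _ _ _ (fun u : R => s + u * (t - s)) b); last exact: bc.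
  have k (c0 : R) : {for u, continuous (fun _ : R => c0)} by exact: contC.
  have i : {for u, continuous (fun u : R => u)} by exact: cvg_id.
  exact: (contD (k _) (contM i (k _))).
- by rewrite mul0r addr0.
- by rewrite mul1r subrKC.
Qed.

Lemma linked_clamp (S : set (R * R)) (p q : R * R) : linked S p q ->
  exists b : R -> R * R, [/\ continuous b, forall t, S (b t), b 0 = p, b 1 = q &
    exists M, forall t, `|(b t).1| < M /\ `|(b t).2| < M].
Proof.
move=> [b [bc bS b0 b1]]; exists (fun t => b (clamp t)); split => //.
- by move=> t; apply: (@continuous_comp _ _ _ (@clamp R) b);
    [exact: continuous_clamp|exact: bc].
- by rewrite clamp_id // lexx ler01.
- by rewrite clamp_id // lexx ler01.
have [M hM] := path_bounded bc.
by exists M => t; apply: hM; exact: clamp_itv.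
Qed.

Lemma linked_shift (S : set (R * R)) n p q : (forall v, S v -> S (shift n v)) ->
  linked S p q -> linked S (shift n p) (shift n q).
Proof. by move=> Sn; apply: linked_map => //; exact: continuous_shift. Qed.

Section Lift.
Variables (C U : set (annulus R)).
Hypotheses (Cconn : connected C) (Cclosed : closed C) (Uo : open U) (CU : C `<=` U).
Hypothesis Uness : ~ essential_open U.
Hypotheses (Cl : forall x, exists a, C a /\ height a < x)
  (Cr : forall x, exists a, C a /\ x < height a).

Let SU : set (R * R) := @proj R @^-1` U.

Let SUo : open SU.
Proof. by have /continuousP := @continuous_proj R; apply. Qed.

Let SUshift n v : SU v -> SU (shift n v).
Proof. by rewrite /SU /= proj_shift. Qed.

(** This is where the neighbourhood [U] being nonessential enters. *)
Let nlinked1 v : ~ linked SU v (shift 1 v).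
Proof.
move=> [b [bc bS b0 b1]]; apply: Uness.
apply: (@essential_path _ _ (mkcts bc)) => //.
by rewrite /= /mkcts b0 b1.
Qed.

Lemma section_proj v : section v.2 (proj v) = v.
Proof.
by rewrite /section /= height_proj branch_expi ?subrr ?normr0 // -surjective_pairing.
Qed.

Lemma section_near v (P : R * R -> Prop) : (\forall w \near v, P w) ->
  \forall a \near proj v, P (section v.2 a) /\ proj (section v.2 a) = a.
Proof.
move=> Pv.
have hv : half v.2 (proj v).2 by exact: half_self.
have h1 : \forall a \near proj v, half v.2 a.2.
  by apply: open_nbhs_nbhs; split => //; exact: continuous_half.
have h2 : \forall a \near proj v, P (section v.2 a).
  have sc := continuous_section hv.
  by apply: sc; rewrite section_proj.
by apply: filterS2 h1 h2 => a ha Pa; split => //; exact: sectionK.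
Qed.

(** The points of [C] with a lift linked to [c0] are open and closed in [C]; for closedness, a short
    path can be moved along the whole fibre because [SU] is invariant under shifts. *)
Let lift_linked (c0 v : R * R) : C (proj c0) -> C (proj v) ->
  exists n, linked SU c0 (shift n v).
Proof.
move=> Cc0 Cv.
pose P := [set a | exists w, proj w = a /\ linked SU c0 w].
suff : P (proj v) by move=> [w [/esym/proj_inj[n ->]]]; exists n.
apply: (connected_clopen (x0 := proj c0) Cconn Cc0) => //.
- by exists c0; split => //; apply: linked_refl; exact: (CU Cc0).
- move=> a Ca [w [wa c0w]]; rewrite -wa.
  have := section_near (linked_near_stable SUo c0w).
  by apply: filterS => a' [? ?]; exists (section w.2 a').
- move=> a Ca nPa; have [w wa] := proj_surj a.
  have SUw : SU w by rewrite /SU /preimage /= wa; exact: CU.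
  rewrite -wa; apply: filterS (section_near (linked_near SUo SUw)) => a' [ww' w'a'].
  move=> [u [ua' c0u]]; apply: nPa.
  have /proj_inj[n nE] : proj (section w.2 a') = proj u by rewrite w'a'.
  exists (shift n w); split; first by rewrite proj_shift.
  apply: linked_trans c0u _; rewrite nE; apply: linked_sym.
  exact: (linked_shift (@SUshift n) ww').
Qed.

(** Reduction to the shift by one. Translates of a path from [v] to [v + (m + 1) tau] chain up to an
    arbitrarily tall vertical path of bounded width. As [C] reaches both ends, a path [e] linked to
    [v] runs from its left to its right; [e + tau] crosses the tall path, which links a point of [e]
    to its own shift. *)
Let nlinked_pos (v : R * R) (m : nat) : C (proj v) -> ~ linked SU v (shift m.+1 v).
Proof.
move=> Cv /linked_clamp[b [bc bS b0 b1 [M bM]]].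
pose T := SU `&` [set w | - M < w.1 < M].
have Tm n w : T w -> T (shift n w) by move=> [SUw wM]; split => //; exact: SUshift.
have vm : linked T v (shift m.+1 v).
  exists b; split => // t; split => //=; have [+ _] := bM t.
  by rewrite ltr_norml.
have Tv := (linked_in vm).1.
have up (k : nat) : linked T v (shift (k%:Z * m.+1) v).
  elim: k => [|k IH]; first by rewrite mul0r shift0; exact: linked_refl.
  apply: linked_trans IH _.
  have -> : k.+1%:Z * m.+1 = m.+1%:Z + k%:Z * m.+1 by lia.
  by rewrite -shiftD; apply: linked_shift vm; exact: Tm.
have [p [Cp pM]] := Cl (- M); have [q [Cq qM]] := Cr M.
have [p' p'E] := proj_surj p; have [q' q'E] := proj_surj q.
have [np vp] : exists n, linked SU v (shift n p') by apply: lift_linked; rewrite ?p'E.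
have [nq vq] : exists n, linked SU v (shift n q') by apply: lift_linked; rewrite ?q'E.
have pq := linked_trans (linked_sym vp) vq.
have [e [ec eS e0 e1 [N eN]]] := linked_clamp pq.
have e0' : (e 0).1 < - M.
  by rewrite e0 /= -height_proj p'E.
have e1' : M < (e 1).1.
  by rewrite e1 /= -height_proj q'E.
pose e' s := shift 1 (e s).
have e'c : continuous e'.
  by move=> s; apply: (@continuous_comp _ _ _ e (shift 1)); [exact: ec|exact: continuous_shift].
(* Tall enough to pass above and below [e']; the extra [1] accounts for the shift of [e]. *)
pose k := (Num.truncn (`|v.2| + N + 1)).+1.
have kN : `|v.2| + N + 1 < k%:R by exact: Num.Theory.truncnS_gt.
have N0 : 0 < N by have [_ /(le_lt_trans (normr_ge0 _))] := eN 0.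
have km : (k%:R : R) <= (k%:Z * m.+1)%:~R.
  by rewrite intrM -[X in X <= _]mulr1 ler_pM2l ?ltr0n // -pmulrn ler1n.
have dn : linked T (shift (- (k%:Z * m.+1)) v) (shift (k%:Z * m.+1) v).
  apply: linked_trans (up k); apply: linked_sym.
  have := @linked_shift T (- (k%:Z * m.+1)) v (shift (k%:Z * m.+1) v) (Tm _) (up k).
  by rewrite shiftK => /linked_sym.
have [g [gc gT g0 g1]] := dn.
have [s [t gt]] : exists s t, g t = e' s.
  apply: crossing => //.
  - move=> t _; have [_ /=] := gT t => /andP[? ?]; apply/andP; split => /=.
      exact: lt_trans e0' _.
    exact: lt_trans e1'.
  - move=> s _; rewrite g0 g1 /=; have [_] := eN s; rewrite ltr_norml => /andP[n1 n2].
    have /andP[v1 v2] : - `|v.2| <= v.2 <= `|v.2| by rewrite -ler_norml.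
    rewrite mulrNz; apply/andP; split; lra.
have SUT w w' : linked T w w' -> linked SU w w' by apply: linked_sub => ? [].
have h1 : linked SU v (g t).
  apply: linked_trans (SUT _ _ (up k)) _; apply: linked_sym; rewrite -g1.
  by apply: SUT; exact: linked_on.
have h2 : linked SU v (e s).
  by apply: linked_trans vp _; rewrite -e0; exact: linked_on.
apply: (@nlinked1 (e s)).
by apply: linked_trans (linked_sym h2) _; rewrite -/(e' s) -gt.
Qed.

Let nlinkedz (c0 v : R * R) n : C (proj v) -> linked SU c0 v ->
  linked SU c0 (shift n v) -> n = 0.
Proof.
move=> Cv c0v c0n.
have vn := linked_trans (linked_sym c0v) c0n.
case: n vn {c0n} => [[|m]|m] vn //.
  by case: (nlinked_pos Cv vn).
case: (@nlinked_pos (shift (Negz m) v) m); first by rewrite proj_shift.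
have -> : shift m.+1 (shift (Negz m) v) = v by rewrite NegzE shiftNK.
exact: linked_sym.
Qed.

(** [C0] is the part over [C] of one component of the lifted neighbourhood. It meets each fibre over
    [C] exactly once, so [proj] has a section [sg] over [C] with image [C0]; its continuity gives
    connectedness, and bounds over compact intervals of the first coordinate. *)
Lemma connector_lift_aux : exists C0 : set (R * R), [/\ closed C0, connected C0,
  forall v, C (proj v) <-> exists n, C0 (shift n v),
  forall v n, C0 v -> C0 (shift n v) -> n = 0 &
  [/\ forall x, exists v, C0 v /\ v.1 < x, forall x, exists v, C0 v /\ x < v.1 &
  forall x1 x2, exists M, forall v, C0 v -> x1 <= v.1 <= x2 -> `|v.2| <= M]].
Proof.
have [a0 [Ca0 _]] := Cl 0; have [c0 c0E] := proj_surj a0.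
have Cc0 : C (proj c0) by rewrite c0E.
pose C0 := [set v | C (proj v) /\ linked SU c0 v].
have C0P v : C (proj v) <-> exists n, C0 (shift n v).
  split=> [Cv|[n [+ _]]]; last by rewrite proj_shift.
  by have [n nE] := lift_linked Cc0 Cv; exists n; split; rewrite ?proj_shift.
have C0u v n : C0 v -> C0 (shift n v) -> n = 0.
  by move=> [Cv c0v] [_ c0n]; exact: nlinkedz c0v c0n.
(* Outside [C] an arbitrary lift serves as default value. *)
have sg_ex a : exists v, proj v = a /\ (C a -> C0 v).
  have [v va] := proj_surj a.
  have [Ca|nCa] := pselect (C a); last by exists v.
  have /C0P[n C0n] : C (proj v) by rewrite va.
  by exists (shift n v); split => //; rewrite proj_shift.
pose sg a := proj1_sig (cid (sg_ex a)).
have sgK a : proj (sg a) = a := (proj2_sig (cid (sg_ex a))).1.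
have sgC a : C a -> C0 (sg a) := (proj2_sig (cid (sg_ex a))).2.
have sgE v : C0 v -> sg (proj v) = v.
  move=> C0v; have /esym/proj_inj[n nE] := sgK (proj v).
  have := sgC (proj v) C0v.1; rewrite nE => /(C0u _ _ C0v) ->.
  by rewrite shift0.
have sgc : {within C, continuous sg}.
  apply/subspace_continuousP => a Ca B nB.
  have [_ c0s] := sgC a Ca.
  have h : \forall a' \near a, (linked SU c0 (section (sg a).2 a') /\
      B (section (sg a).2 a')) /\ proj (section (sg a).2 a') = a'.
    have nn : \forall w \near sg a, linked SU c0 w /\ B w.
      exact: filterI (linked_near_stable SUo c0s) nB.
    by have := section_near nn; rewrite sgK.
  suff : \forall a' \near a, C a' -> B (sg a') by [].
  apply: filterS h => a' [[c0a' Ba'] a'E] Ca'.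
  have -> : sg a' = section (sg a).2 a' by rewrite -[in LHS]a'E sgE //; split; rewrite ?a'E.
  exact: Ba'.
have C0E : sg @` C = C0.
  apply/seteqP; split => [_ [a Ca <-]|v C0v]; first exact: sgC.
  by exists (proj v); [case: C0v|exact: sgE].
exists C0; split => //.
- rewrite -openC openE => v nv; rewrite /interior.
  have [Cv|nCv] := pselect (C (proj v)).
    have ncv : ~ linked SU c0 v by move=> c0v; exact: nv.
    by apply: filterS (nlinked_near_stable SUo (CU Cv) ncv) => w ncw [].
  have Po : open (@proj R @^-1` (~` C)).
    by have /continuousP := @continuous_proj R; apply; rewrite openC.
  have Pv : nbhs v (@proj R @^-1` (~` C)) by exact: open_nbhs_nbhs.
  by apply: filterS Pv => w nCw [].
- by rewrite -C0E; exact: connected_continuous_connected.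
split.
- move=> x; have [a [Ca ax]] := Cl x; exists (sg a); split; first exact: sgC.
  by rewrite -height_proj sgK.
- move=> x; have [a [Ca ax]] := Cr x; exists (sg a); split; first exact: sgC.
  by rewrite -height_proj sgK.
move=> x1 x2.
(* A rectangle one turn high covers all points of the annulus with height in [[x1, x2]], so [K] is
   compact. *)
pose K := (@proj R @` (`[x1, x2] `*` `[0, 1])) `&` C.
have Kc : compact K.
  apply: compact_closedI => //; apply: continuous_compact.
    exact: continuous_subspaceT (@continuous_proj R).
  by apply: compact_setX; exact: segment_compact.
have fc : {within K, continuous (fun a => (sg a).2 : R^o)}.
  have : {within K, continuous sg} by apply: continuous_subspaceW sgc => ? [].
  by move=> sc a; exact: (cont_snd (sc a)).
have [M [Mr hM]] := compact_bounded (continuous_compact fc Kc).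
exists (M + 1) => v C0v v12; apply: hM; first by rewrite ltrDl.
exists (proj v); last by rewrite sgE.
split; last by case: C0v.
exists (shift (- Num.floor v.2) v); last by rewrite proj_shift.
have := Num.Theory.floor_itv v.2; rewrite intrD => /andP[f0 f1].
by split => /=; rewrite in_itv //= mulrNz; apply/andP; split; lra.
Qed.

End Lift.

Lemma connector_lift (C : set (annulus R)) : trivial_connector C ->
  exists C0 : set (R * R), [/\ closed C0, connected C0,
  forall v, C (proj v) <-> exists n, C0 (shift n v),
  forall v n, C0 v -> C0 (shift n v) -> n = 0 &
  [/\ forall x, exists v, C0 v /\ v.1 < x, forall x, exists v, C0 v /\ x < v.1 &
  forall x1 x2, exists M, forall v, C0 v -> x1 <= v.1 <= x2 -> `|v.2| <= M]].
Proof.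
move=> [[Cconn Cclosed Cends] Cness].
have [U [Uo CU Uness]] : exists U : set (annulus R),
    [/\ open U, C `<=` U & ~ essential_open U].
  apply: contrapT => nU; apply: Cness => U Uo CU.
  by apply: contrapT => Un; apply: nU; exists U.
apply: (connector_lift_aux Cconn Cclosed Uo CU Uness) => x.
  have [p [_ [Cp _ px _]]] := Cends _ (rho_gt0 x).
  by exists p; split => //; rewrite -ltr_rho rho_height.
have r1 : 0 < 1 - rho x.
  by have := rho_itv x; rewrite /open_interval /= in_itv /= subr_gt0 => /andP[].
have [_ [q [_ Cq _ qx]]] := Cends _ r1.
by exists q; split => //; rewrite -ltr_rho rho_height; move: qx; rewrite subKr.
Qed.

End ConnectorLift.

(** * The height function of a lifted connector *)

Section Distance.
Context (R : realType) (A : set (R * R)).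
Hypotheses (Ac : closed A) (A0 : A !=set0).

Definition dist_set (v : R * R) : R := inf [set `|v - a| | a in A].

Let has_inf_dist v : has_inf [set `|v - a| | a in A].
Proof.
split; first by have [a Aa] := A0; exists `|v - a|, a.
by exists 0 => _ [a _ <-].
Qed.

Lemma dist_set_ge0 v : 0 <= dist_set v.
Proof. by apply: lb_le_inf; [have [] := has_inf_dist v|move=> _ [a _ <-]]. Qed.

Lemma dist_set_lip v w : dist_set v - dist_set w <= `|v - w|.
Proof.
rewrite lerBlDr -lerBlDl; apply: lb_le_inf; first by have [] := has_inf_dist w.
move=> _ [a Aa <-]; rewrite lerBlDl.
have : dist_set v <= `|v - a| by apply: ge_inf; [have [] := has_inf_dist v|exists a].
move=> /le_trans; apply.
have -> : v - a = (v - w) + (w - a) by rewrite addrA subrK.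
exact: ler_normD.
Qed.

Lemma continuous_dist_set : continuous dist_set.
Proof.
move=> v; apply/cvgrPdist_lt => e e0.
have h : \forall w \near v, `|v - w| < e.
  by apply/nbhs_ballP; exists e => // w; rewrite -ball_normE.
apply: filterS h => w vw; apply: le_lt_trans vw.
by rewrite ler_norml lerNl opprB (distrC v) dist_set_lip distrC dist_set_lip.
Qed.

Lemma dist_set_eq0 v : dist_set v = 0 <-> A v.
Proof.
split=> [d0|Av].
  apply: contrapT => nAv.
  have Ao : open (~` A) by rewrite openC.
  have /nbhs_ballP[e e0 eA] : nbhs v (~` A) by exact: open_nbhs_nbhs.
  have [_ [a Aa <-] ae] := inf_adherent e0 (has_inf_dist v).
  rewrite -/(dist_set v) d0 add0r in ae.
  by apply: (eA a) => //; rewrite -ball_normE.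
apply/eqP; rewrite eq_le dist_set_ge0 andbT.
by apply: ge_inf; [have [] := has_inf_dist v|exists v => //; rewrite subrr normr0].
Qed.

End Distance.

Section Lines.
Context (R : realType).

Lemma linked_vertical (S : set (R * R)) (x y1 y2 : R) : y1 <= y2 ->
  (forall y, y1 <= y <= y2 -> S (x, y)) -> linked S (x, y1) (x, y2).
Proof.
move=> y12 xS; apply: linked_line => t /andP[t0 t1] /=.
rewrite subrr mulr0 addr0; apply: xS; apply/andP; split; nra.
Qed.

Lemma linked_horizontal (S : set (R * R)) (x1 x2 y : R) :
  (forall x, Num.min x1 x2 <= x <= Num.max x1 x2 -> S (x, y)) ->
  linked S (x1, y) (x2, y).
Proof.
move=> yS; apply: linked_line => t /andP[t0 t1] /=.
rewrite subrr mulr0 addr0; apply: yS.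
have [x12|x12] := leP x1 x2; apply/andP; split; nra.
Qed.

End Lines.

(** * The strips between consecutive translates of the lifted connector *)

Section Height.
Context (R : realType) (C0 : set (R * R)).
Implicit Types (v w : R * R) (n : int).
Hypotheses (C0c : closed C0) (C0conn : connected C0).
Hypothesis C0u : forall v n, C0 v -> C0 (shift n v) -> n = 0.
Hypotheses (C0l : forall x, exists v, C0 v /\ v.1 < x)
  (C0r : forall x, exists v, C0 v /\ x < v.1).
Hypothesis C0b : forall x1 x2, exists M, forall v, C0 v -> x1 <= v.1 <= x2 -> `|v.2| <= M.

Let S0 := ~` C0.

Let S0o : open S0. Proof. by rewrite openC. Qed.

Let N_ex : exists N : R, 0 < N /\ forall y, C0 (0, y) -> `|y| < N.
Proof.
have [M hM] := C0b 0 0; exists (`|M| + 1); split; first by rewrite ltr_wpDl.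
move=> y /hM /=; rewrite lexx => /(_ isT) /le_lt_trans; apply.
by rewrite ltr_pwDr // ler_norm.
Qed.

Let N := proj1_sig (cid N_ex).
Let N_gt0 : 0 < N. Proof. by rewrite /N; case: cid => ? []. Qed.
Let C0N y : C0 (0, y) -> `|y| < N. Proof. by rewrite /N; case: cid => ? [_ +] /=; apply. Qed.

(** Reference points for the two sides of [C0], on the vertical axis beyond the reach of [C0]. *)
Let top : R * R := (0, N).
Let bot : R * R := (0, - N).

Let S0ray y : N <= `|y| -> S0 (0, y).
Proof. by move=> Ny /C0N; rewrite ltNge Ny. Qed.

(** Connectedness of [C0] does not provide paths inside it. But [C0] avoids the closed set [G] made
    of the alleged path and two vertical rays, so a path in the open complement of [G] joins points
    of [C0] far to the left and right; it would have to cross [G]. *)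
Let nlinked_bot_top : ~ linked S0 bot top.
Proof.
move=> /linked_clamp[b [bc bS b0 b1 [M bM]]].
pose ray := [set v : R * R | v.1 = 0 /\ N <= `|v.2|].
pose G := ray `|` b @` `[0, 1].
have rayc : closed ray.
  have -> : ray = (fst @^-1` [set 0]) `&` ((fun v : R * R => `|v.2|) @^-1` [set y | N <= y]).
    by [].
  apply: closedI.
    apply: preimage_closed; last exact: closed_eq.
    by move=> v _; exact: cvg_fst.
  apply: preimage_closed; last exact: closed_ge.
  move=> v _; apply: (@cont_norm _ _ (fun v : R * R => v.2)); exact: cvg_snd.
have Gc : closed G.
  apply: closedU => //; apply: compact_closed; first exact: plane_hausdorff.
  by apply: continuous_compact; [exact: continuous_subspaceT|exact: segment_compact].
have Gno : open (~` G) by rewrite openC.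
have [p [C0p pM]] := C0l (- M); have [q [C0q qM]] := C0r M.
have C0G : C0 `<=` ~` G.
  move=> v C0v [[v1 v2]|[t _ tv]].
    by apply: (S0ray v2); rewrite -v1 -surjective_pairing.
  by apply: (bS t); rewrite tv.
have /linked_clamp[e [ec eG e0 e1 [Y eY]]] := connected_linked Gno C0conn C0G C0p C0q.
have M0 : 0 < M by have [/(le_lt_trans (normr_ge0 _))] := bM 0.
have Y0 : 0 < Y by have [/(le_lt_trans (normr_ge0 _))] := eY 0.
have Nn := N_gt0.
have GM v : G v -> `|v.1| < M.
  by case=> [[-> _]|[t _ <-]]; [rewrite normr0|have [] := bM t].
have up : linked G top (0, N + Y).
  apply: linked_vertical => [|y /andP[y1 y2]]; first by rewrite lerDl ltW.
  by left; split => //=; rewrite (le_trans y1) // ler_norm.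
have dn : linked G (0, - (N + Y)) bot.
  apply: linked_vertical => [|y /andP[y1 y2]]; first by rewrite lerN2 lerDl ltW.
  by left; split => //=; rewrite ler0_norm; lra.
have mid : linked G bot top.
  rewrite -b0 -b1; exists (fun t => b (clamp t)); split.
  - by move=> t; apply: (@continuous_comp _ _ _ (@clamp R) b);
      [exact: continuous_clamp|exact: bc].
  - by move=> t; right; exists (clamp t) => //=; rewrite in_itv; exact: clamp_itv.
  - by rewrite clamp_id // lexx ler01.
  - by rewrite clamp_id // lexx ler01.
have [g [gc gG g0 g1]] := linked_trans dn (linked_trans mid up).
have [s [t gt]] : exists s t, g t = e s.
  apply: crossing => //.
  - move=> t _; have := GM _ (gG t); rewrite ltr_norml e0 e1 => /andP[g1' g2'].
    by rewrite (lt_trans pM) // (lt_trans g2').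
  - move=> s _; have [_] := eY s; rewrite ltr_norml g0 g1 /= => /andP[e1' e2'].
    apply/andP; split; lra.
by apply: (eG s); rewrite -gt.
Qed.

(** Between the abscissas [0] and [v.1] the set [C0] is bounded, so horizontal segments at large
    ordinates avoid it. *)
Let far v : exists K : nat, forall k : int, (K%:Z <= k)%R ->
  linked S0 top (shift k v) /\ linked S0 bot (shift (- k) v).
Proof.
have [M hM] := C0b (Num.min 0 v.1) (Num.max 0 v.1).
pose K := (Num.truncn (`|M| + `|v.2| + N)).+1.
have KN : `|M| + `|v.2| + N < K%:R by exact: Num.Theory.truncnS_gt.
exists K => k Kk; have {}KN : `|M| + `|v.2| + N < k%:~R.
  by apply: lt_le_trans KN _; rewrite pmulrn ler_int.
have /andP[v1 v2] : - `|v.2| <= v.2 <= `|v.2| by rewrite -ler_norml.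
have M0 := normr_ge0 M; have MM := ler_norm M; have Nn := N_gt0.
have v0 := normr_ge0 v.2.
have hor y : M < `|y| -> linked S0 (0, y) (v.1, y).
  move=> My; apply: linked_horizontal => x xv C0xy.
  by have := hM _ C0xy xv; rewrite leNgt My.
split.
  have Nk : N <= v.2 + k%:~R by lra.
  have y0 : 0 <= v.2 + k%:~R by lra.
  apply: linked_trans (hor (v.2 + k%:~R) _); last by rewrite ger0_norm //; lra.
  apply: linked_vertical => // y /andP[y1 _]; apply: S0ray.
  by apply: le_trans y1 (ler_norm _).
have Nk : v.2 - k%:~R <= - N by lra.
have y0 : v.2 - k%:~R <= 0 by lra.
rewrite /shift mulrNz.
apply: linked_trans (hor (v.2 - k%:~R) _); last by rewrite ler0_norm //; lra.
apply: linked_sym; apply: linked_vertical => // y /andP[_ y1]; apply: S0ray.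
by rewrite ler0_norm; lra.
Qed.

Let C0_0 : exists y, C0 (0, y).
Proof.
have c1 : {within C0, continuous (fst : R * R -> R)}.
  by apply: continuous_subspaceT => v; exact: cvg_fst.
have /connected_intervalP I := connected_continuous_connected C0conn c1.
have [p [C0p p0]] := C0l 0; have [q [C0q q0]] := C0r 0.
have [v C0v v0] := I p.1 q.1 (ex_intro2 _ _ _ C0p erefl) (ex_intro2 _ _ _ C0q erefl) 0
  (introT andP (conj (ltW p0) (ltW q0))).
by exists v.2; rewrite -v0 -surjective_pairing.
Qed.

Let connected_shift n : connected (shift n @` C0).
Proof.
apply: connected_continuous_connected => //.
exact: continuous_subspaceT (@continuous_shift R n).
Qed.

Let shift_S0 n : n != 0 -> shift n @` C0 `<=` S0.
Proof. by move=> n0 _ [v C0v <-] /(C0u C0v) /eqP; apply/negP. Qed.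

(** Take a point [(0, y)] of [C0] less than [1] below the supremum of [C0] on the axis. From [y + 1]
    upward the axis avoids [C0], and [(0, y + 1)] lies on the translate, which is connected and
    disjoint from [C0]. *)
Let ups v : C0 v -> linked S0 top (shift 1 v).
Proof.
move=> C0v; have [y0 C0y0] := C0_0.
pose E := [set y | C0 (0, y)].
have hE : has_sup E.
  by split; [exists y0|exists N => y /C0N /(le_lt_trans (ler_norm _)) /ltW].
have [y Ey ys] := sup_adherent (ltr01 : 0 < 1) hE.
have above z : y + 1 <= z -> S0 (0, z).
  by move=> yz /(sup_upper_bound hE); rewrite leNgt => /negP; apply; lra.
have ty : linked S0 top (0, y + 1).
  have [yN|/ltW Ny] := leP (y + 1) N.
    apply: linked_sym; apply: linked_vertical => // z /andP[z1 _]; exact: above.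
  apply: linked_vertical => // z /andP[z1 _]; apply: S0ray.
  exact: le_trans z1 (ler_norm _).
apply: linked_trans ty _.
have C1 : shift 1 @` C0 `<=` S0 by exact: shift_S0.
have y1 : (shift 1 @` C0) (0, y + 1) by exists (0, y).
have v1 : (shift 1 @` C0) (shift 1 v) by exists v.
exact: (connected_linked S0o (@connected_shift 1) C1 y1 v1).
Qed.

Let downs v : C0 v -> linked S0 bot (shift (-1) v).
Proof.
move=> C0v; have [y0 C0y0] := C0_0.
pose E := [set y | C0 (0, y)].
have lN y : E y -> - N < y by move=> /C0N; rewrite ltr_norml => /andP[].
have hE : has_inf E by split; [exists y0|exists (- N) => y /lN /ltW].
have [y Ey ys] := inf_adherent (ltr01 : 0 < 1) hE.
have below z : z <= y - 1 -> S0 (0, z).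
  by move=> yz /(ge_inf hE.2); rewrite leNgt => /negP; apply; lra.
have ty : linked S0 bot (0, y - 1).
  have [yN|/ltW Ny] := leP (y - 1) (- N).
    apply: linked_sym; apply: linked_vertical => // z /andP[_ z1]; apply: S0ray.
    by have Nn := N_gt0; rewrite ler0_norm; lra.
  apply: linked_vertical => // z /andP[_ z1]; exact: below.
apply: linked_trans ty _.
have C1 : shift (-1) @` C0 `<=` S0 by exact: shift_S0.
have y1 : (shift (-1) @` C0) (0, y - 1) by exists (0, y) => //; rewrite /shift mulrNz.
have v1 : (shift (-1) @` C0) (shift (-1) v) by exists v.
exact: (connected_linked S0o (@connected_shift (-1)) C1 y1 v1).
Qed.

(** The component above [C0]; adding [C0] itself gives the closed region [Q]. *)
Let R0 v := linked S0 top v.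

Let C0_below v : C0 v -> ~ R0 (shift (-1) v).
Proof.
move=> C0v tv; apply: nlinked_bot_top.
exact: linked_trans (downs C0v) (linked_sym tv).
Qed.

(** A shifted path from [top] cannot meet [C0]: before the shift the point would lie on [C0 - tau],
    which is below [C0]. *)
Let R0_up v : R0 v -> R0 (shift 1 v).
Proof.
move=> [b [bc bS b0 b1]].
apply: (@linked_trans _ _ _ (shift 1 top)).
  apply: linked_vertical => /=; first by rewrite lerDl.
  by move=> y /andP[y1 _]; apply: S0ray; exact: le_trans y1 (ler_norm _).
exists (fun t => shift 1 (b t)); rewrite b0 b1; split => //.
- by move=> t; apply: (@continuous_comp _ _ _ b (shift 1)); [exact: bc|exact: continuous_shift].
- move=> t /C0_below; rewrite shiftD subrr shift0; apply.
  by rewrite /R0 -b0; exact: linked_on.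
Qed.

Let Q v := R0 v \/ C0 v.

Let Q_up v : Q v -> R0 (shift 1 v).
Proof. by case=> [/R0_up|/ups]. Qed.

Let R0_S0 v : R0 v -> S0 v. Proof. by move=> tv; have [] := linked_in tv. Qed.

Let R0o : open [set v | R0 v].
Proof. by rewrite openE => v tv; exact: (linked_near_stable S0o tv). Qed.

Let Qc : closed [set v | Q v].
Proof.
rewrite -openC openE => v /= nQ.
have S0v : S0 v by move=> C0v; apply: nQ; right.
have nR0 : ~ R0 v by move=> ?; apply: nQ; left.
apply: filterS2 (nlinked_near_stable S0o S0v nR0) (linked_near S0o S0v) => w nw vw.
by case=> // C0w; have [_] := linked_in vw; apply.
Qed.

Let A := ~` [set v | R0 v].
Let B := (shift (-1) @^-1` [set v | Q v]).

Let Aclosed : closed A. Proof. by rewrite closedC. Qed.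

Let Bclosed : closed B.
Proof. by apply: preimage_closed => // v _; exact: continuous_shift. Qed.

Let A_ne : A !=set0.
Proof. by exists bot => /linked_sym; exact: nlinked_bot_top. Qed.

Let B_ne : B !=set0.
Proof.
have [y C0y] := C0_0; exists (shift 1 (0, y)).
by right; rewrite shiftK.
Qed.

Let AB v : A v -> B v -> False.
Proof. by move=> Av /Q_up; rewrite shiftNK. Qed.

(** The Urysohn function of [A], all that is not above [C0], and [B], all that is on or above
    [C0 + tau]. It vanishes only on [A] and reaches [1] only on [B], so no new integral heights
    appear inside a strip. *)
Let g v := dist_set A v / (dist_set A v + dist_set B v).

Let den_gt0 v : 0 < dist_set A v + dist_set B v.
Proof.
have A0 := dist_set_ge0 A_ne v; have B0 := dist_set_ge0 B_ne v.
rewrite lt_neqAle addr_ge0 // andbT eq_sym paddr_eq0 //.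
apply/negP => /andP[/eqP /(dist_set_eq0 Aclosed A_ne) Av /eqP /(dist_set_eq0 Bclosed B_ne) Bv].
exact: AB Av Bv.
Qed.

Let gc v : {for v, continuous g}.
Proof.
apply: (@contM _ _ (dist_set A) (fun v => (dist_set A v + dist_set B v)^-1)).
  exact: continuous_dist_set.
apply: contV; first by rewrite gt_eqF.
by apply: contD; exact: continuous_dist_set.
Qed.

Let g0 v : ~ R0 v -> g v = 0.
Proof. by move=> Av; rewrite /g (dist_set_eq0 Aclosed A_ne v).2 // mul0r. Qed.

Let g0_R0 v : g v = 0 -> ~ R0 v.
Proof.
move=> /eqP; rewrite mulf_eq0 invr_eq0 (gt_eqF (den_gt0 v)) orbF => /eqP.
by move=> /(dist_set_eq0 Aclosed A_ne).
Qed.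

Let g1 v : Q (shift (-1) v) -> g v = 1.
Proof.
move=> Bv; rewrite /g (dist_set_eq0 Bclosed B_ne v).2 // addr0 mulfV //.
by have := den_gt0 v; rewrite (dist_set_eq0 Bclosed B_ne v).2 // addr0 => /gt_eqF ->.
Qed.

Let g_itv v : ~ Q (shift (-1) v) -> 0 <= g v < 1.
Proof.
move=> nB; rewrite divr_ge0 ?addr_ge0 ?dist_set_ge0 //= ltr_pdivrMr // mul1r ltrDl.
rewrite lt_neqAle dist_set_ge0 // andbT; apply/negP => /eqP/esym.
by move=> /(dist_set_eq0 Bclosed B_ne).
Qed.

(** The strip of [v]: from [C0 + k tau], included, up to [C0 + (k + 1) tau], excluded. *)
Let isidx v k := Q (shift (- k) v) /\ ~ Q (shift (- k - 1) v).

Let Q_le v (m n : int) : (m <= n)%R -> Q (shift m v) -> Q (shift n v).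
Proof.
move=> mn Qm; have -> : n = m + `|n - m|%N%:Z by lia.
elim: (`|n - m|%N) => [|k IH]; first by rewrite addr0.
have -> : m + k.+1%:Z = (m + k%:Z) + 1 by lia.
by rewrite -shiftD; left; exact: Q_up.
Qed.

(** By [far], membership of the shifted point in [Q] fails at [- K] and holds at [K]; the index is
    read off where it changes. *)
Let idx_ex v : exists k, isidx v k.
Proof.
have [K hK] := far v; have [up dn] := hK K (lexx _).
have PN : ~ Q (shift (- K%:Z) v).
  case=> [tv|]; last by have [_] := linked_in dn; apply.
  apply: nlinked_bot_top; exact: linked_trans dn (linked_sym tv).
suff H (j : nat) : Q (shift (- K%:Z + j%:Z) v) -> exists k, isidx v k.
  apply: (H (K + K)%N).
  have -> : - K%:Z + (K + K)%N%:Z = K by lia.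
  by left.
elim: j => [|j IH]; first by rewrite addr0.
have [Qj|nQj] := pselect (Q (shift (- K%:Z + j%:Z) v)); first by move=> _; exact: IH.
move=> Qj1; exists (K%:Z - j.+1%:Z); split.
  by have -> : - (K%:Z - j.+1%:Z) = - K%:Z + j.+1%:Z by lia.
by have -> : - (K%:Z - j.+1%:Z) - 1 = - K%:Z + j%:Z by lia.
Qed.

Let idx v := proj1_sig (cid (idx_ex v)).
Let idxP v : isidx v (idx v) := proj2_sig (cid (idx_ex v)).

Let isidx_uniq v k l : isidx v k -> isidx v l -> k = l.
Proof.
move=> [Qk nQk] [Ql nQl].
case: (ltgtP k l) => // kl; exfalso.
  by apply: nQk; apply: Q_le Ql; lia.
by apply: nQl; apply: Q_le Qk; lia.
Qed.

Definition strip_height v : R := (idx v)%:~R + g (shift (- idx v) v).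

Lemma continuous_strip_height : continuous strip_height.
Proof.
move=> v; pose k := idx v; have [Qk nQk] := idxP v; rewrite -/k in Qk nQk.
have r1 : \forall w \near v, R0 (shift (- k + 1) w).
  have : R0 (shift (- k + 1) v) by rewrite -shiftD; exact: Q_up.
  by move=> h; apply: (@continuous_shift R (- k + 1) v _ (open_nbhs_nbhs (conj R0o h))).
have r2 : \forall w \near v, ~ Q (shift (- k - 1) w).
  have o : open (~` [set v | Q v]) by rewrite openC.
  by apply: (@continuous_shift R (- k - 1) v _ (open_nbhs_nbhs (conj o nQk))).
have gs n w : {for w, continuous (fun w => g (shift n w))}.
  by apply: (@continuous_comp _ _ _ (shift n) g); [exact: continuous_shift|exact: gc].
(* Near [v] the index is [k] or [k - 1], and one continuous formula serves both: in the upper strip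
   the first [g] is [1], in the lower one the second [g] is [0]. *)
apply: (@near_continuous _ _ (fun w => (k - 1)%:~R + g (shift (- k + 1) w) + g (shift (- k) w))).
  apply: filterS2 r1 r2 => w r1w r2w.
  have [Qw|nQw] := pselect (Q (shift (- k) w)).
    have E : idx w = k by apply: (@isidx_uniq w) => //; exact: idxP.
    rewrite /strip_height E (@g1 (shift (- k + 1) w)); last first.
      by rewrite shiftD addrK.
    by rewrite rmorphB /= subrK.
  have E : idx w = k - 1.
    apply: (@isidx_uniq w); first exact: idxP.
    split; first by rewrite opprB addrC; left.
    by have -> : - (k - 1) - 1 = - k by lia.
  rewrite /strip_height E (@g0 (shift (- k) w)); last by move=> ?; apply: nQw; left.
  have -> : - (k - 1) = - k + 1 by lia.
  by rewrite addr0.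
have kc (c0 : R) : {for v, continuous (fun _ : R * R => c0)} by exact: contC.
exact: (contD (contD (kc _) (gs _ v)) (gs _ v)).
Qed.

Lemma strip_height_shift v : strip_height (shift 1 v) = strip_height v + 1.
Proof.
have E : idx (shift 1 v) = idx v + 1.
  apply: (@isidx_uniq (shift 1 v)); first exact: idxP.
  have [Q1 Q2] := idxP v; split; rewrite shiftD.
    by have -> : 1 - (idx v + 1) = - idx v by lia.
  by have -> : 1 + (- (idx v + 1) - 1) = - idx v - 1 by lia.
rewrite /strip_height E shiftD.
have -> : 1 - (idx v + 1) = - idx v by lia.
by rewrite intrD addrAC.
Qed.

(** Within its half-open strip [g] lies in [[0, 1[], so an integral height makes it vanish; on [Q]
    that happens only along [C0]. *)
Lemma strip_height_int v : (exists n : int, C0 (shift n v)) <->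
  exists n : int, strip_height v = n%:~R.
Proof.
split=> [[n C0n]|[n H]].
  have nR0 : ~ R0 (shift n v) by move=> /R0_S0; apply.
  exists (- n).
  have E : idx v = - n.
    apply: (@isidx_uniq v); first exact: idxP.
    rewrite /isidx opprK; split; first by right.
    rewrite -shiftD; case; first exact: (C0_below C0n).
    by move=> /(C0u C0n).
  by rewrite /strip_height E opprK g0 // addr0.
have [Q1 Q2] := idxP v; exists (- idx v).
have /andP[ge0 lt1] : 0 <= g (shift (- idx v) v) < 1 by apply: g_itv; rewrite shiftD.
suff : g (shift (- idx v) v) = 0 by move=> /g0_R0 nR0; case: Q1.
have E : g (shift (- idx v) v) = (n - idx v)%:~R.
  by rewrite rmorphB /= -H /strip_height addrAC subrr add0r.
move: ge0 lt1; rewrite E ler0z ltrz1 => ? ?.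
by have -> : n - idx v = 0 by lia.
Qed.

End Height.

(** * Limit of the rescaled heights *)

Lemma connector_height (R : realType) (C : set (annulus R)) : trivial_connector C ->
  exists phi : R * R -> R, [/\ continuous phi,
    forall v, phi (shift 1 v) = phi v + 1 &
    forall v, C (proj v) <-> exists n : int, phi v = n%:~R].
Proof.
move=> /connector_lift[C0 [C0c C0conn CC0 C0u [C0l C0r C0b]]].
exists (strip_height C0conn C0l C0r C0b); split.
- exact: continuous_strip_height.
- exact: strip_height_shift.
- by move=> v; rewrite CC0; exact: strip_height_int.
Qed.

(** * Equivariant functions on the plane and their descent to the annulus *)

Section Descent.
Context (R : realType).

Lemma plane_connected : connected [set: R * R].
Proof.
pose line (v : R * R) : set (R * R) := range (fun t => (t * v.1, t * v.2)).
have -> : [set: R * R] = \bigcup_(v in setT) line v.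
  apply/seteqP; split => // v _; exists v => //; exists 1 => //.
  by rewrite !mul1r -surjective_pairing.
apply: bigcup_connected.
  by exists (0, 0) => v _; exists 0 => //; rewrite !mul0r.
move=> v _; apply: connected_continuous_connected.
  by apply/connected_intervalP => x y _ _ z _.
exact: continuous_subspaceT (continuous_seg (v := v)).
Qed.

Lemma equivariantz (F : R * R -> R * R) (d m : int) v :
  (forall v, F (shift 1 v) = shift d (F v)) -> F (shift m v) = shift (m * d) (F v).
Proof.
move=> Fs; have P (k : nat) w : F (shift k w) = shift (k%:Z * d) (F w).
  elim: k => [|k IH]; first by rewrite mul0r !shift0.
  have -> : (k.+1 : int) = k%:Z + 1 by lia.
  by rewrite -shiftD Fs IH shiftD mulrDl mul1r.
case: m => m; first exact: P.
have := P m.+1 (shift (Negz m) v); rewrite {1}NegzE shiftNK => ->.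
by rewrite shiftD NegzE mulNr addrN shift0.
Qed.

Lemma shift_addz (psi : R * R -> R) n v :
  (forall v, psi (shift 1 v) = psi v + 1) -> psi (shift n v) = psi v + n%:~R.
Proof.
move=> ps; pose P v : R * R := (0, psi v).
have := @equivariantz P 1 n v; rewrite /P mulr1 => /(_ _)/(congr1 snd) /=; apply.
by move=> w; rewrite ps.
Qed.

(** [base] jumps, but it differs from a local continuous section by deck transformations, which
    [psi] ignores. *)
Lemma descend_continuous (Y : topologicalType) (psi : R * R -> Y) :
  continuous psi -> (forall v n, psi (shift n v) = psi v) ->
  continuous (fun a => psi (base a)).
Proof.
move=> pc ps a; have [v va] := proj_surj a.
have hv : half v.2 a.2 by rewrite -va; exact: half_self.
have sc := continuous_section hv.
apply: (@near_continuous _ _ (fun a => psi (section v.2 a))); last first.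
  by apply: (@continuous_comp _ _ _ (section v.2) psi) => //; exact: pc.
have : \forall b \near a, half v.2 b.2.
  by apply: open_nbhs_nbhs; split => //; exact: continuous_half.
apply: filterS => b hb.
by rewrite [section v.2 b in LHS]baseE ps sectionK.
Qed.

Lemma base_invariant (Y : Type) (psi : R * R -> Y) (v : R * R) :
  (forall v n, psi (shift n v) = psi v) -> psi (base (proj v)) = psi v.
Proof. by move=> ps; rewrite [in RHS](baseE v) ps. Qed.

Lemma connected_int_constant (X : topologicalType) (C : set X) (u : X -> R) :
  connected C -> continuous u -> (forall x, C x -> exists n : int, u x = n%:~R) ->
  exists j : int, forall x, C x -> u x = j%:~R.
Proof.
move=> Cc uc uZ.
have [[x0 Cx0]|noC] := pselect (C !=set0); last first.
  by exists 0 => x Cx; exfalso; apply: noC; exists x.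
have [j jE] := uZ x0 Cx0; exists j => x Cx; have [n nE] := uZ x Cx.
have /connected_intervalP I : connected (u @` C).
  by apply: connected_continuous_connected => //; exact: continuous_subspaceT.
have Ij : (u @` C) j%:~R by exists x0.
have In : (u @` C) n%:~R by exists x.
have half_int (m k : int) : (u @` C) m%:~R -> (u @` C) k%:~R -> (m < k)%R -> False.
  move=> Im Ik mk.
  have mk1 : m%:~R + 1 <= k%:~R :> R by rewrite -[1]/(1%:~R) -intrD ler_int; lia.
  have [] := I _ _ Im Ik (m%:~R + 1 / 2); first by apply/andP; split; lra.
  move=> y /uZ[l ->] lE.
  have l1 : m%:~R < l%:~R :> R by rewrite lE; lra.
  have l2 : l%:~R < (m + 1)%:~R :> R by rewrite lE intrD; lra.
  by move: l1 l2; rewrite !ltr_int; lia.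
rewrite nE; congr (_%:~R).
by case: (ltgtP n j) => // h; exfalso; [exact: half_int In Ij h|exact: half_int Ij In h].
Qed.

Lemma geometric_small (x K : R) : (forall n : nat, `|x| <= K / 2 ^+ n) -> x = 0.
Proof.
move=> xK; apply/eqP; rewrite -normr_eq0; apply/negP => /negP x0.
have {}x0 : 0 < `|x| by rewrite lt_neqAle eq_sym x0 normr_ge0.
pose n := (Num.truncn (K / `|x|)).+1.
have Kn : K / `|x| < n%:R by exact: Num.Theory.truncnS_gt.
have n2 : n%:R <= 2 ^+ n :> R by rewrite -natrX ler_nat ltnW // ltn_expl.
have := xK n; rewrite leNgt => /negP; apply.
rewrite ltr_pdivrMr ?exprn_gt0 // mulrC -ltr_pdivrMr //.
exact: lt_le_trans Kn n2.
Qed.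

End Descent.

(* The semi-conjugacy is the limit of [phi (F^n v) / d^n]; the sequences
   [u_n - B / 2^n] and [u_n + B / 2^n] are monotone. *)
Section Limit.
Context (R : realType) (F : R * R -> R * R) (phi : R * R -> R) (d : int) (B : R).
Hypotheses (Fc : continuous F) (phic : continuous phi) (d2 : (1 < `|d|)%R).
Hypotheses (Fs : forall v, F (shift 1 v) = shift d (F v))
  (phis : forall v n, phi (shift n v) = phi v + n%:~R).
Hypothesis phiF : forall v, `|phi (F v) - d%:~R * phi v| <= B.

Let D : R := d%:~R.

Let D2 : 2 <= `|D|.
Proof. by rewrite /D -intr_norm -[2]/(2%:~R) ler_int; lia. Qed.

Let D0 : D != 0. Proof. by rewrite -normr_gt0; have := D2; lra. Qed.

Let u n v := phi (iter n F v) / D ^+ n.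

Let B0 : 0 <= B. Proof. exact: le_trans (normr_ge0 _) (phiF (0, 0)). Qed.

(** The defect bound at [F^n v], divided by [D ^ n.+1] with [|D| >= 2]. These bounds sum from [n] on
    to [B / 2 ^ n], the margin in [lo] and [hi]. *)
Let u_step n v : `|u n.+1 v - u n v| <= B / 2 ^+ n.+1.
Proof.
have -> : u n.+1 v - u n v = (phi (F (iter n F v)) - D * phi (iter n F v)) / D ^+ n.+1.
  rewrite /u /= mulrBl; congr (_ - _).
  by rewrite exprS invfM mulrACA mulfV // mul1r.
have D2' := D2; have Dp : 0 < `|D| by lra.
rewrite normrM normfV normrX; apply: ler_pM => //.
- by rewrite lef_pV2 ?posrE ?exprn_gt0 // lerXn2r ?nnegrE // ltW.
Qed.

Let halve n : B / 2 ^+ n = B / 2 ^+ n.+1 + B / 2 ^+ n.+1.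
Proof. by rewrite exprS invfM mulrCA; field; rewrite expf_eq0 andbC pnatr_eq0. Qed.

Let lo v n := u n v - B / 2 ^+ n.
Let hi v n := u n v + B / 2 ^+ n.

Let lo_mono v m n : (m <= n)%N -> lo v m <= lo v n.
Proof.
elim: n => [|n IH]; first by rewrite leqn0 => /eqP ->.
rewrite leq_eqVlt => /orP[/eqP -> //|/IH /le_trans]; apply.
have := u_step n v; rewrite ler_norml /lo (halve n) => /andP[? ?]; lra.
Qed.

Let hi_mono v m n : (m <= n)%N -> hi v n <= hi v m.
Proof.
elim: n => [|n IH]; first by rewrite leqn0 => /eqP ->.
rewrite leq_eqVlt => /orP[/eqP -> //|/IH]; apply: le_trans.
have := u_step n v; rewrite ler_norml /hi (halve n) => /andP[? ?]; lra.
Qed.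

Let lo_hi v m n : lo v m <= hi v n.
Proof.
apply: le_trans (lo_mono v (leq_maxl m n)) _.
apply: le_trans (hi_mono v (leq_maxr m n)).
by rewrite /lo /hi lerD2l ge0_cp // divr_ge0 // exprn_ge0.
Qed.

Definition limit_height v : R := sup (range (lo v)).

Lemma limit_heightP n v : `|limit_height v - u n v| <= B / 2 ^+ n.
Proof.
have hs : has_sup (range (lo v)).
  by split; [exists (lo v 0), 0%N|exists (hi v 0) => _ [m _ <-]; exact: lo_hi].
have l : lo v n <= limit_height v by apply: sup_upper_bound => //; exists n.
have h : limit_height v <= hi v n.
  by apply: ge_sup; [exists (lo v 0), 0%N|move=> _ [m _ <-]; exact: lo_hi].
by rewrite ler_norml; move: l h; rewrite /lo /hi => l h; apply/andP; split; lra.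
Qed.

Let uc n : continuous (u n).
Proof.
have ic : continuous (iter n F).
  elim: n => [|n IH] v; first exact: cvg_id.
  by apply: (@continuous_comp _ _ _ (iter n F) F); [exact: IH|exact: Fc].
move=> v; apply: (@contM _ _ (fun v => phi (iter n F v)) (fun=> _)); last exact: contC.
by apply: (@continuous_comp _ _ _ (iter n F) phi); [exact: ic|exact: phic].
Qed.

Lemma continuous_limit_height : continuous limit_height.
Proof.
move=> v; apply/cvgrPdist_lt => e e0.
(* Through [n <= 2 ^ n] this gives [B / 2 ^ n < e / 4]: two approximation errors and one variation
   of [u n] then stay below [e]. *)
pose n := (Num.truncn (4 * B / e)).+1.
have Bn : 4 * B / e < n%:R by exact: Num.Theory.truncnS_gt.
have n2 : n%:R <= 2 ^+ n :> R by rewrite -natrX ler_nat ltnW // ltn_expl.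
have Be : B / 2 ^+ n < e / 4.
  rewrite ltr_pdivrMr ?exprn_gt0 //; rewrite ltr_pdivrMr // in Bn.
  have : e * n%:R <= e * 2 ^+ n by rewrite ler_pM2l.
  lra.
have /cvgrPdist_lt/(_ (e / 4)) := @uc n v.
have e4 : 0 < e / 4 by rewrite divr_gt0.
move=> /(_ e4); apply: filterS => w uw.
have h1 := limit_heightP n v; have h2 := limit_heightP n w.
move: uw h1 h2; rewrite !ltr_norml !ler_norml => /andP[? ?] /andP[? ?] /andP[? ?].
by apply/andP; split; lra.
Qed.

(** The approximants satisfy [u n (F v) = u n.+1 v * D] exactly, so only the two approximation
    errors remain, and they shrink geometrically. *)
Lemma limit_height_F v : limit_height (F v) = limit_height v * D.
Proof.
apply/eqP; rewrite -subr_eq0; apply/eqP.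
apply: (@geometric_small _ _ (B + `|D| * B)) => n.
have h1 := limit_heightP n (F v); have h2 := limit_heightP n.+1 v.
have uE : u n (F v) = u n.+1 v * D.
  by rewrite /u -iterSr exprSr invfM mulrA divfK.
have -> : limit_height (F v) - limit_height v * D =
   (limit_height (F v) - u n (F v)) - (limit_height v - u n.+1 v) * D.
  by rewrite uE; ring.
apply: le_trans (ler_normB _ _) _; rewrite [leRHS]mulrDl; apply: lerD => //.
rewrite normrM mulrC -mulrA ler_wpM2l //; apply: le_trans h2 _.
by rewrite [leRHS]halve lerDl divr_ge0 // exprn_ge0.
Qed.

Lemma limit_height_shift v n : limit_height (shift n v) = limit_height v + n%:~R.
Proof.
have iF k w (m : int) : iter k F (shift m w) = shift (m * d ^+ k) (iter k F w).
  by elim: k => [|k IH] /=; rewrite ?mulr1 // IH (equivariantz _ _ Fs) exprSr mulrA.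
have uE k : u k (shift n v) = u k v + n%:~R.
  rewrite /u iF phis intrM mulrDl; congr (_ + _).
  by rewrite rmorphXn /= -/D mulfK // expf_neq0.
apply/eqP; rewrite -subr_eq0; apply/eqP.
apply: (@geometric_small _ _ (B + B)) => k.
have h1 := limit_heightP k (shift n v); have h2 := limit_heightP k v.
have -> : limit_height (shift n v) - (limit_height v + n%:~R) =
   (limit_height (shift n v) - u k (shift n v)) - (limit_height v - u k v).
  by rewrite uE; ring.
by apply: le_trans (ler_normB _ _) _; rewrite [leRHS]mulrDl; apply: lerD.
Qed.

End Limit.

(** * The semiconjugacy *)

(* Descending from [q] until [phi] first meets a value [j + d * k], the height of
   the preimage under [F] stays between two consecutive integers. *)
Section BoundedHeight.
Context (R : realType).

(** The inequalities at [s] are weak because [c] may be attained at [s] itself, the first hit. *)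
Lemma no_crossing (u : R -> R) (c s : R) : continuous u -> s <= 0 ->
  (forall t, s < t <= 0 -> u t != c) ->
  (c <= u 0 -> c <= u s) /\ (u 0 <= c -> u s <= c).
Proof.
move=> uc s0 uN; split=> u0; rewrite leNgt; apply/negP => us.
  have [|t] := @IVT R u s 0 c s0 (continuous_subspaceT uc).
    by rewrite ge_min (ltW us) le_max u0 orbT.
  rewrite in_itv /= => /andP[st t0] utc.
  have st' : s < t.
    by rewrite lt_neqAle st andbT; apply/eqP => E; move: us; rewrite E utc ltxx.
  by have := uN t; rewrite st' t0 utc eqxx => /(_ isT).
have [|t] := @IVT R u s 0 c s0 (continuous_subspaceT uc).
  by rewrite ge_min u0 orbT le_max (ltW us).
rewrite in_itv /= => /andP[st t0] utc.
have st' : s < t.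
  by rewrite lt_neqAle st andbT; apply/eqP => E; move: us; rewrite E utc ltxx.
by have := uN t; rewrite st' t0 utc eqxx => /(_ isT).
Qed.

(** Along a vertical line, [al] is the height and [be] the height of the preimage under [F]; [hit]
    marks where that preimage lies over the connector. In the bound, [|j|] is the offset at a hit,
    one [|d|] bounds the variation of [al] since then, and the other is [|d|] times the variation,
    at most [1], of [be]. *)
Lemma bounded_difference (al be : R -> R) (j d : int) (hit : set R) : (1 < `|d|)%R ->
  continuous al -> continuous be -> closed hit ->
  (forall t, hit t <-> exists n : int, be t = n%:~R) ->
  (forall t, hit t <-> exists n : int, al t = (j + d * n)%:~R) ->
  (forall t, hit t -> al t = j%:~R + d%:~R * be t) ->
  al (- `|d|%:~R) = al 0 - `|d|%:~R ->
  `|al 0 - d%:~R * be 0| <= `|j|%:~R + 2 * `|d|%:~R.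
Proof.
move=> d1 alc bec hitc hb ha hab ald.
pose D : R := `|d|%:~R; rewrite -/D in ald *.
have D1 : 1 < D by rewrite /D -[1]/(1%:~R) ltr_int.
(* [l] is the last of the levels [j + |d| m] that is not above [al 0]. *)
pose m := Num.floor ((al 0 - j%:~R) / D).
pose l : R := j%:~R + D * m%:~R.
have lv n : (al n = l \/ al n = l + D) -> hit n.
  (* The levels [j + d n] and [j + |d| n] are the same set, whatever the sign of [d]. *)
  have dE k : exists n : int, D * k%:~R = d%:~R * n%:~R :> R.
    rewrite /D; case: (lerP 0 d) => d0; first by exists k; rewrite ger0_norm.
    by exists (- k); rewrite ltr0_norm // !mulrNz mulrN mulNr.
  move=> alE; apply/ha.
  have [k kE] : exists k : int, al n = j%:~R + D * k%:~R.
    case: alE => ->; first by exists m.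
    by exists (m + 1); rewrite /l intrD mulrDr mulr1 addrA.
  have [i iE] := dE k; exists i.
  by rewrite kE iE intrD intrM.
have /andP[m0 m1] := Num.Theory.floor_itv ((al 0 - j%:~R) / D).
rewrite -/m in m0 m1.
rewrite ler_pdivlMr in m0; last by lra.
rewrite intrD ltr_pdivrMr in m1; last by lra.
have l0 : l <= al 0 by rewrite /l; lra.
have l1 : al 0 <= l + D by rewrite /l; lra.
(* Going down by [|d|] lowers [al] by [|d|], hence to [l] or below, so there is a hit on the way;
   the supremum of [T] is the first one met from [0]. *)
pose T := [set t | - D <= t <= 0] `&` hit.
have T0 : T !=set0.
  have D0 : - D <= 0 by lra.
  have [|t] := @IVT R al (- D) 0 l D0 (continuous_subspaceT alc).
    by rewrite ge_min le_max l0 orbT andbT ald; apply/orP; left; lra.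
  rewrite in_itv /= => tD tl; exists t; split => //.
  by apply: lv; left.
have Tc : closed T.
  apply: closedI => //.
  have -> : [set t : R | - D <= t <= 0] = [set` `[- D, 0]].
    by apply/seteqP; split => t /=; rewrite in_itv.
  exact: interval_closed.
have Tu : has_ubound T by exists 0 => t [/andP[]].
pose s := sup T.
have Ts : T s by rewrite /s; apply: Tc; exact: closure_sup.
have [/andP[sD s0] hs] := Ts.
have nohit t : s < t <= 0 -> ~ hit t.
  move=> /andP[st t0] ht.
  have : t <= s.
    apply: sup_upper_bound; first by split.
    by split => //; apply/andP; split => //; lra.
  by rewrite leNgt st.
have aln c : (forall t, al t = c -> hit t) -> forall t, s < t <= 0 -> al t != c.
  by move=> ch t st; apply/eqP => /ch; exact: nohit.
have ben (n : int) t : s < t <= 0 -> be t != n%:~R.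
  by move=> st; apply/eqP => E; apply: (nohit t st); apply/hb; exists n.
have [a1 _] := no_crossing alc s0 (aln l (fun t E => lv t (or_introl E))).
have [_ a2] := no_crossing alc s0 (aln (l + D) (fun t E => lv t (or_intror E))).
have := a1 l0; have := a2 l1 => al2 al1.
pose k := Num.floor (be 0).
have /andP[k0 k1] := Num.Theory.floor_itv (be 0); rewrite -/k in k0 k1.
have [b1 _] := no_crossing bec s0 (ben k).
have [_ b2] := no_crossing bec s0 (ben (k + 1)).
have be1 := b1 k0; have be2 := b2 (ltW k1).
rewrite intrD in k1 be2.
have E : al 0 - d%:~R * be 0 = j%:~R + (al 0 - al s) + d%:~R * (be s - be 0).
  by rewrite (hab s hs); ring.
rewrite E.
apply: le_trans (ler_normD _ _) _.
have h1 : `|al 0 - al s| <= D by rewrite ler_norml; apply/andP; split; lra.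
have h2 : `|d%:~R * (be s - be 0)| <= D.
  have b3 : `|be s - be 0| <= 1 by rewrite ler_norml; apply/andP; split; lra.
  rewrite normrM -intr_norm -/D -[leRHS]mulr1; apply: ler_wpM2l => //; lra.
have h3 := ler_normD (j%:~R) (al 0 - al s).
rewrite -intr_norm in h3; lra.
Qed.

End BoundedHeight.

Theorem corollary8 (R : realType) (d : int) (d_gt1 : 1 < `|d|)
    (f : continuousType (annulus R) (annulus R))
    (f_cov : covering_map f) (f_deg : has_degree f d)
    (f_conn : exists C : set (annulus R), trivial_connector C /\ f @` C = C) :
  exists h : continuousType (annulus R) (circle R), semiconjugacy f d h.
Proof.
have [C [Ctriv fC]] := f_conn.
have [[Cconn Cclosed _] _] := Ctriv.
have [phi [phic phi1 phiC]] := connector_height Ctriv.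
have phis v n := shift_addz n v phi1.
have fc : continuous f := @cts_fun _ _ f.
have pc := @continuous_proj R.
have fpc : continuous (fun v => f (proj v)).
  by move=> v; apply: (@continuous_comp _ _ _ (@proj R) f); [exact: pc|exact: fc].
have [e0 e0E] := proj_surj (f (proj (0, 0))).
have [F [Fc FE _]] := lift_proj fpc e0E.
have [n0 n0E] : exists n, forall v, F (shift 1 v) = shift n (F v).
  have Fsc : continuous (fun v => F (shift 1 v)).
    move=> v; apply: (@continuous_comp _ _ _ (shift 1) F); last exact: Fc.
    exact: continuous_shift.
  apply: (lift_proj_unique (@plane_connected R) Fc Fsc) => v.
  by rewrite !FE proj_shift.
(* The shift is read off on homology: [f] sends the core class to [n0] times itself. *)
have nd : n0 = d.
  apply: (@has_degree_lift _ f (mkcts Fc) d n0 f_deg) => //.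
  by rewrite /= /mkcts -n0E; congr F; rewrite /shift /= add0r.
have Fs v : F (shift 1 v) = shift d (F v) by rewrite -nd.
have [_ fsurj _] := f_cov.
have fls := covering_locally_sectioned f_cov.
(* [proj] lifts through the covering [f], and that lift lifts again to the plane: this is an inverse
   of [F] up to a deck transformation. *)
have [a _ fa] := fsurj (proj (0, 0)) I.
have [g [gc gE _]] := lift_plane fls (@annulus_hausdorff R) pc fa.
have [e1 e1E] := proj_surj (g (0, 0)).
have [G0 [G0c G0E _]] := lift_proj gc e1E.
have [m mE] : exists m, forall v, F (G0 v) = shift m v.
  have FGc : continuous (fun v => F (G0 v)).
    by move=> v; apply: (@continuous_comp _ _ _ G0 F); [exact: G0c|exact: Fc].
  have idc : continuous (fun v : R * R => v) by move=> v; exact: cvg_id.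
  apply: (lift_proj_unique (@plane_connected R) idc FGc) => v.
  by rewrite FE G0E gE.
pose G v := G0 (shift (- m) v).
have Gc : continuous G.
  move=> v; apply: (@continuous_comp _ _ _ (shift (- m)) G0); last exact: G0c.
  exact: continuous_shift.
have FG v : F (G v) = v by rewrite mE shiftNK.
(* [proj] and [proj \o G \o F] both lift [f \o proj] through [f] and agree at [G (0, 0)], hence
   everywhere; the remaining deck transformation is trivial, as seen at the same point. *)
have GF v : G (F v) = v.
  have GFc : continuous (fun v => G (F v)).
    by move=> w; apply: (@continuous_comp _ _ _ F G); [exact: Fc|exact: Gc].
  have pGFc : continuous (fun v => proj (G (F v))).
    by move=> w; apply: (@continuous_comp _ _ _ (fun v => G (F v)) (@proj R)); [exact: GFc|exact: pc].
  have idc : continuous (fun v : R * R => v) by move=> w; exact: cvg_id.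
  have pE : forall w, proj w = proj (G (F w)).
    apply: (lift_unique fls (@annulus_hausdorff R) (@plane_connected R) pc pGFc
      (x0 := G (0, 0))) => [w|]; last by rewrite FG.
    by rewrite -!FE FG.
  have [k kE] := lift_proj_unique (@plane_connected R) idc GFc pE.
  have := kE (G (0, 0)); rewrite FG => /(congr1 snd) /= /eqP.
  rewrite addrC -subr_eq subrr eq_sym intr_eq0 => /eqP k0.
  by rewrite kE k0 shift0.
pose th v := phi (F v) - d%:~R * phi v.
have thc : continuous th.
  have c1 : continuous (fun v => phi (F v)).
    by move=> v; apply: (@continuous_comp _ _ _ F phi); [exact: Fc|exact: phic].
  move=> v; have kc : {for v, continuous (fun _ : R * R => d%:~R : R)} by exact: contC.
  exact: (contB (c1 v) (contM kc (phic v))).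
have ths v n : th (shift n v) = th v.
  by rewrite /th (equivariantz _ _ Fs) !phis intrM; ring.
(* [th] descends to the annulus and is integral on [C], because [f] maps [C] into itself; [C] is
   connected. *)
have [j jE] : exists j : int, forall v, C (proj v) -> phi (F v) = j%:~R + d%:~R * phi v.
  have [j jE] : exists j : int, forall b, C b -> th (base b) = j%:~R.
    apply: (connected_int_constant Cconn).
      exact: (descend_continuous thc ths).
    move=> b Cb; have [v vb] := proj_surj b; rewrite -vb (base_invariant _ ths).
    have [n1 n1E] : exists n : int, phi v = n%:~R by apply/phiC; rewrite vb.
    have [n2 n2E] : exists n : int, phi (F v) = n%:~R.
      by apply/phiC; rewrite FE -fC; exists (proj v) => //; rewrite vb.
    by exists (n2 - d * n1); rewrite /th n1E n2E intrD mulrNz intrM.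
  exists j => v Cv; have := jE _ Cv; rewrite (base_invariant _ ths) /th => <-.
  by rewrite subrK.
(* Here [f] mapping [C] onto itself matters: a point at level [j + d n] is a deck translate of some
   [F c'] with [c'] over [C]. Comparing levels, the translation is by [d (n - l)], which [F] absorbs
   as a shift of [c'] by [n - l]; injectivity of [F] then identifies the preimage. *)
have CF v : (exists n : int, phi v = (j + d * n)%:~R) -> C (proj (G v)).
  move=> [n nE].
  have : (f @` C) (proj v) by rewrite fC; apply/phiC; exists (j + d * n).
  move=> [c Cc]; have [c' c'E] := proj_surj c.
  rewrite -c'E -FE => /proj_inj[k kE].
  have [l lE] : exists l : int, phi c' = l%:~R by apply/phiC; rewrite c'E.
  have := phis (F c') k; rewrite -kE nE jE ?c'E // lE.
  rewrite -intrM -!intrD => /intr_inj E.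
  have -> : v = F (shift (n - l) c').
    rewrite (equivariantz _ _ Fs) kE; congr (shift _ _).
    by rewrite mulrC mulrBr; move: E; lia.
  by rewrite GF proj_shift c'E.
have thB v : `|th v| <= `|j|%:~R + 2 * `|d|%:~R.
  (* The bound is obtained on the vertical line through [F v], whose pullback by [G] passes through
     [v]. *)
  pose q := F v.
  pose dn (t : R) : R * R := (q.1, q.2 + t).
  have dnc : continuous dn.
    move=> t; have k1 (c0 : R) : {for t, continuous (fun _ : R => c0)} by exact: contC.
    have k2 : {for t, continuous (fun t : R => t)} by exact: cvg_id.
    exact: (cont_pair (k1 _) (contD (k1 _) k2)).
  have Gdn : continuous (fun t => G (dn t)).
    by move=> t; apply: (@continuous_comp _ _ _ dn G); [exact: dnc|exact: Gc].
  pose hit : set R := [set t | C (proj (G (dn t)))].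
  have hitc : closed hit.
    apply: (@preimage_closed _ _ (fun t => proj (G (dn t))) C) => // t _.
    apply: (@continuous_comp _ _ _ (fun t => G (dn t)) (@proj R)); first exact: Gdn.
    exact: pc.
  have dn0 : dn 0 = q by rewrite /dn addr0 -surjective_pairing.
  have := @bounded_difference R (fun t => phi (dn t)) (fun t => phi (G (dn t))) j d hit.
  rewrite /= dn0 /q GF; apply => //.
  - by move=> t; apply: (@continuous_comp _ _ _ dn phi); [exact: dnc|exact: phic].
  - by move=> t; apply: (@continuous_comp _ _ _ (fun t => G (dn t)) phi); [exact: Gdn|exact: phic].
  - by move=> t; exact: (phiC (G (dn t))).
  - move=> t; split; last exact: (CF (dn t)).
    move=> Ct; have [n nE] := (phiC _).1 Ct; exists n.
    by rewrite -[dn t]FG jE // nE intrD intrM.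
  - by move=> t Ct; rewrite -[in LHS](FG (dn t)) jE.
  - have -> : dn (- `|d|%:~R) = shift (- `|d|) q by rewrite /dn /shift mulrNz.
    by rewrite phis mulrNz.
pose H := limit_height F phi d (`|j|%:~R + 2 * `|d|%:~R).
have Hc : continuous H := continuous_limit_height Fc phic d_gt1 thB.
have HF v : H (F v) = H v * d%:~R := limit_height_F d_gt1 thB v.
have Hs v n : H (shift n v) = H v + n%:~R := limit_height_shift d_gt1 Fs phis thB v n.
pose psi v := expi (H v).
have psic : continuous psi.
  by move=> v; apply: (@continuous_comp _ _ _ H (@expi R)); [exact: Hc|exact: continuous_expi].
have psis v n : psi (shift n v) = psi v by rewrite /psi Hs expiDz.
pose h := mkcts (descend_continuous psic psis).
have hE v : h (proj v) = expi (H v) by exact: (base_invariant _ psis).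
exists h; split.
  move=> b; have [v <-] := proj_surj b.
  change (h (f (proj v)) = circle_pow d (h (proj v))).
  by rewrite -FE !hE HF circle_pow_expi mulrzr.
apply: (H1map_circle_bij Hc) => //.
have -> : (0, 1) = shift 1 (0, 0) :> R * R by rewrite /shift /= add0r.
by rewrite Hs.
Qed.
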